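(* Let $f:(0,\infty)\to(0,1]$ be a function that decreases to zero and is regularly varying at infinity with index of regular variation $-\gamma$, where $\gamma\in[0,1)$. Let $c^{\rm glob}_t$ be the global clustering coefficient of the random multigraph $G_t(f)$. Then $$ \lim_{t\to\infty}\frac{\log c^{\rm glob}_t}{\log t}=-\frac{1-\gamma}{2}\quad\text{almost surely.} $$
   Context: Multigraphs may have loops and multiple edges; a loop contributes 2 to the degree of its vertex. For a finite connected multigraph $G$, $\pi_G$ is the probability distribution on its vertices $\pi_G(v)=\deg(v)/\sum_{w\in G}\deg(w)$. Process $G_t(f)$: let $(Z_t)_{t\ge1}$ be independent with $Z_t\sim\mathrm{Ber}(f(t))$. $G_0$ is one vertex with one self-loop. Given $G_t$ and independently of the past: if $Z_{t+1}=1$ (vertex-step), add a new vertex and connect it by one edge to a vertex of $G_t$ chosen according to $\pi_{G_t}$; if $Z_{t+1}=0$ (edge-step), add a new edge between two vertices of $G_t$ chosen independently, each according to $\pi_{G_t}$ (possibly creating a loop or a multiple edge). The result is $G_{t+1}$. For a multigraph $G$ let $\widehat G$ be the simple graph obtained by removing loops and reducing multiple edges to single edges; $\Delta(G)$ is the number of triangles of $\widehat G$ and $\Lambda(G)$ the number of cherries (paths of length two, counted as subgraphs) of $\widehat G$. The global clustering coefficient is $c^{\rm glob}_t=3\,\Delta(G_t(f))/\Lambda(G_t(f))$ (defined when $\Lambda(G_t(f))>0$). A function $f:(0,\infty)\to(0,\infty)$ is regularly varying at infinity with index $\beta\in\mathbb{R}$ if $\lim_{t\to\infty}f(at)/f(t)=a^{\beta}$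 for all $a>0$. *)

(* Defs.v *)
From HB Require Import structures.
From mathcomp Require Import all_boot all_order all_algebra.
From mathcomp Require Import all_classical all_reals all_analysis.

Set Implicit Arguments.
Unset Strict Implicit.
Unset Printing Implicit Defensive.
Import Order.TTheory GRing.Theory Num.Theory.
Import numFieldNormedType.Exports.
Local Open Scope classical_set_scope.
Local Open Scope ring_scope.

(* The vertices are 0, ..., nv - 1, numbered by order of arrival.  The edges
   are listed in order of arrival, each as an ordered pair of endpoints; loops
   and repetitions are allowed.  Order and orientation are bookkeeping only:
   no quantity below depends on them.  Only graphs with all endpoints below nv
   are reached by the process. *)
Record multigraph := Multigraph { nv : nat ; edges : seq (nat * nat) }.

Definition one_loop : multigraph := Multigraph 1 [:: (0%N, 0%N)].

Definition add_vertex (g : multigraph) (v : nat) : multigraph :=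
  Multigraph (nv g).+1 (rcons (edges g) (nv g, v)).

Definition add_edge (g : multigraph) (v w : nat) : multigraph :=
  Multigraph (nv g) (rcons (edges g) (v, w)).

(* A loop at v is counted by both terms. *)
Definition deg (g : multigraph) (v : nat) : nat :=
  (count (fun e => e.1 == v) (edges g) + count (fun e => e.2 == v) (edges g))%N.

Definition pi_deg (R : realType) (g : multigraph) (v : nat) : R :=
  (deg g v)%:R / (\sum_(w < nv g) deg g w)%:R.

(* Adjacency in the simple graph underlying g. *)
Definition adj (g : multigraph) (u v : nat) : bool :=
  (u != v) && (((u, v) \in edges g) || ((v, u) \in edges g)).

Definition triangles (g : multigraph) : nat :=
  #|[pred A : {set 'I_(nv g)} |
      (#|A| == 3)%N && [forall u in A, forall v in A, (u != v) ==> adj g u v]]|.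

(* A cherry is given by its centre p.1 and the pair p.2 of its end vertices,
   which may themselves be adjacent. *)
Definition cherries (g : multigraph) : nat :=
  #|[pred p : 'I_(nv g) * {set 'I_(nv g)} |
      (#|p.2| == 2)%N && [forall u in p.2, adj g p.1 u]]|.

(* Equal to 0 when there is no cherry, since x / 0 = 0.  As also ln 0 = 0, a
   nonzero limit of ln (global_clustering R (g t)) / ln t can exist only if
   cherries (g t) and triangles (g t) are eventually positive. *)
Definition global_clustering (R : realType) (g : multigraph) : R :=
  3%:R * (triangles g)%:R / (cherries g)%:R.

Definition regularly_varying (R : realType) (f : R -> R) (beta : R) : Prop :=
  (forall x, 0 < x -> 0 < f x) /\
  (forall a, 0 < a -> f (a * t) / f t @[t --> +oo] --> a `^ beta).

Definition past (T : Type) (Z : nat -> T -> bool) (G : nat -> T -> multigraph)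
    (t : nat) (z : nat -> bool) (g : nat -> multigraph) : set T :=
  [set omega | (forall s, (1 <= s <= t)%N -> Z s omega = z s) /\
               (forall s, (s <= t)%N -> G s omega = g s)].

(* (G t) is the process G_t(f), with step indicators Z t for t >= 1 (Z 0 is
   not used).  The values of (Z, G) up to a given time form a countable set, so
   that measurability and conditioning are expressed on single values.
   The field gp_bernoulli says that Z (t+1) is Ber(f (t+1)) and independent of
   the past; in particular (Z t), t >= 1, is an independent sequence.
   As v, resp. (v, w), is determined by add_vertex g v, resp. add_edge g v w,
   the last two fields give the whole conditional law of G (t+1) given Z (t+1)
   and the past; the pair (v, w) is ordered, hence no factor 2. *)
Record graph_process (R : realType) (d : measure_display)
    (T : measurableType d) (P : probability T R) (f : R -> R)
    (Z : nat -> T -> bool) (G : nat -> T -> multigraph) : Prop := {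
  gp_measurable_Z : forall t b, measurable [set omega | Z t omega = b] ;
  gp_measurable_G : forall t h, measurable [set omega | G t omega = h] ;
  gp_init : forall omega, G 0%N omega = one_loop ;
  gp_bernoulli : forall t z g,
    P (past Z G t z g `&` [set omega | Z t.+1 omega = true]) =
    (P (past Z G t z g) * (f t.+1%:R)%:E)%E ;
  gp_vertex_step : forall t z g v, (v < nv (g t))%N ->
    P (past Z G t z g `&` [set omega | Z t.+1 omega = true]
        `&` [set omega | G t.+1 omega = add_vertex (g t) v]) =
    (P (past Z G t z g `&` [set omega | Z t.+1 omega = true])
       * (pi_deg R (g t) v)%:E)%E ;
  gp_edge_step : forall t z g v w, (v < nv (g t))%N -> (w < nv (g t))%N ->
    P (past Z G t z g `&` [set omega | Z t.+1 omega = false]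
        `&` [set omega | G t.+1 omega = add_edge (g t) v w]) =
    (P (past Z G t z g `&` [set omega | Z t.+1 omega = false])
       * (pi_deg R (g t) v * pi_deg R (g t) w)%:E)%E
}.

(* Main.v *)
Require Import Defs.
From HB Require Import structures.
From mathcomp Require Import all_boot all_order all_algebra.
From mathcomp Require Import all_classical all_reals all_analysis.
From mathcomp Require Import ring lra zify.
Set Implicit Arguments.
Unset Strict Implicit.
Unset Printing Implicit Defensive.
Import Order.TTheory GRing.Theory Num.Theory.
Import numFieldNormedType.Exports.
Local Open Scope classical_set_scope.
Local Open Scope ring_scope.

(* Write V = t^(1 - gamma); all estimates hold up to factors t^o(1).  There are
   about V vertices, and the vertex that arrived at time s has degree about t / s,
   so that two vertices are adjacent when the product of their arrival times is
   at most t.  It suffices to show that there are about V adjacencies, that some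
   vertex has about V neighbours, and that there is a clique of size V^(1/2):
   triangles are at most adjacencies^(3/2) (Loomis-Whitney) and cherries at most
   adjacencies times vertices, hence there are V^(3/2) triangles and V^2 cherries.

   Upper bound (trivial for gamma = 0): with weights b_u^q, where b_u is the
   arrival time and q is slightly below gamma, the second moment of the weighted
   total degree gives the expectation of the sum over the edges uv
   of (b_u b_v)^q, which bounds the number of adjacent pairs with b_u b_v > t.
   Lower bound: a negative moment of a degree times a power of time is decreasing,
   so that most of the vertices present at time t^a have degree at least
   t^(1 - a - eta) at time t; two vertices whose degrees at time t have product at
   least t^(1 + e) are adjacent at time 2t except with probability
   exp(- c t^e).

   As triangles, cherries, adjacencies and vertices can only increase, all bounds
   are needed along t = 2^k only, where Markov's inequality and Borel-Cantelli
   apply. *)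

(** * Conditional expectations of functions of the graph *)

(** One edge per step makes the total degree [2 * (t + 1)] whatever the history, so the denominators
    of [pi_deg] are deterministic and conditional means obey simple recursive inequalities. All
    moments are computed with the finite operator [run]; measure theory enters only where [run] is
    compared with [P].

    Upper bound: an edge-step adds to the weighted edge sum, on average, the square of the mean
    weight of a vertex chosen by [pi_deg]; hence the second moment. The pairs with [b_u b_v <= tau]
    number at most [tau^p] times the square of the sum of the [b_u^(-p)], where [p = 1 - q] is
    slightly above [1 - gamma]. That sum has bounded mean and the weighted edge sum has mean of
    order [t], so [tau] of order [t] makes both contributions of order [t^p].

    Lower bound: means of degrees do not exclude small degrees, whereas a negative moment (of
    exponent -1/2) does so by Markov's inequality alone, with no concentration estimate.
    Conditioning at time [t] freezes the degrees, and the edge-steps between [t] and [2 * t] then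
    create the adjacencies, which avoids any joint analysis of degrees and adjacency. *)

Definition wf (t : nat) (g : multigraph) : Prop :=
  [/\ size (edges g) = t.+1, (0 < nv g)%N, (nv g <= t.+1)%N,
      (forall e, e \in edges g -> (e.1 < nv g)%N && (e.2 < nv g)%N) &
      (forall v, (v < nv g)%N -> (0 < deg g v)%N)].

Lemma wf_one_loop : wf 0 one_loop.
Proof.
split; [by []|by []|by []| |] => [e|v].
  by rewrite inE => /eqP ->.
by rewrite ltnS leqn0 => /eqP ->.
Qed.

Lemma deg_add_vertex g u v : deg (add_vertex g u) v =
  (deg g v + ((nv g == v) + (u == v)))%N.
Proof. by rewrite /deg /= -!cats1 !count_cat /= !addn0 addnACA. Qed.

Lemma deg_add_edge g u w v : deg (add_edge g u w) v =
  (deg g v + ((u == v) + (w == v)))%N.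
Proof. by rewrite /deg /= -!cats1 !count_cat /= !addn0 addnACA. Qed.

Lemma wf_add_vertex t g v : wf t g -> (v < nv g)%N -> wf t.+1 (add_vertex g v).
Proof.
case=> Hs Hp Hn He Hd vg; split=> //=.
- by rewrite size_rcons Hs.
- move=> e; rewrite mem_rcons inE => /predU1P[->|/He/andP[a b]] /=.
    by rewrite ltnSn (ltn_trans vg).
  by rewrite (ltn_trans a) // (ltn_trans b).
- move=> u; rewrite deg_add_vertex ltnS leq_eqVlt => /predU1P[->|/Hd].
    by rewrite eqxx addnA addnAC addn1.
  by move=> a; rewrite ltn_addr.
Qed.

Lemma wf_add_edge t g v w : wf t g -> (v < nv g)%N -> (w < nv g)%N ->
  wf t.+1 (add_edge g v w).
Proof.
case=> Hs Hp Hn He Hd vg wg; split=> //=.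
- by rewrite size_rcons Hs.
- exact: leqW.
- move=> e; rewrite mem_rcons inE => /predU1P[->|/He//] /=.
  by rewrite vg wg.
- by move=> u /Hd a; rewrite deg_add_edge ltn_addr.
Qed.

Lemma sum_deg_edges (V : nmodType) g n (x : nat -> V) :
  (forall e, e \in edges g -> (e.1 < n)%N && (e.2 < n)%N) ->
  \sum_(v < n) x v *+ deg g v = \sum_(e <- edges g) (x e.1 + x e.2).
Proof.
rewrite /deg; elim: (edges g) => [|e s IH] He.
  by rewrite big_nil big1.
rewrite big_cons -IH; last by move=> e' e's; apply: He; rewrite inE e's orbT.
have /andP[e1 e2] : (e.1 < n)%N && (e.2 < n)%N by apply: He; rewrite inE eqxx.
under eq_bigr do rewrite /= addnACA mulrnDr.
rewrite big_split /=; congr (_ + _).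
under eq_bigr do rewrite mulrnDr.
rewrite big_split /= (bigD1 (Ordinal e1)) //= eqxx mulr1n.
rewrite [X in _ + X + _]big1 ?addr0; last first.
  move=> i ie; rewrite (_ : e.1 == i = false) //.
  by apply: contraNF ie => /eqP ei; apply/eqP/val_inj.
rewrite (bigD1 (Ordinal e2)) //= eqxx mulr1n.
rewrite [X in _ + (_ + X)]big1 ?addr0 //.
move=> i ie; rewrite (_ : e.2 == i = false) //.
by apply: contraNF ie => /eqP ei; apply/eqP/val_inj.
Qed.

Lemma sum_deg t g : wf t g -> (\sum_(w < nv g) deg g w)%N = t.+1.*2.
Proof.
case=> Hs _ _ He _; have := @sum_deg_edges nat g (nv g) (fun=> 1) He.
under eq_bigr do rewrite natn /=; move=> ->.
by rewrite big_const_seq count_predT Hs iter_addr_0 mulrnDl !natn -addnn.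
Qed.

Lemma pi_degE (R : realType) t g v : wf t g ->
  pi_deg R g v = (deg g v)%:R / t.+1.*2%:R.
Proof. by move=> w; rewrite /pi_deg (sum_deg w). Qed.

Lemma pi_deg_ge0 (R : realType) g v : 0 <= pi_deg R g v.
Proof. by rewrite divr_ge0. Qed.

Lemma sum_pi_deg (R : realType) t g : wf t g ->
  \sum_(v < nv g) pi_deg R g v = 1.
Proof.
move=> w; rewrite -mulr_suml -natr_sum (sum_deg w) divff //.
Qed.

Lemma sum_pi_deg_edges (R : realType) t g (x : nat -> R) : wf t g ->
  \sum_(v < nv g) pi_deg R g v * x v =
  (\sum_(e <- edges g) (x e.1 + x e.2)) / t.+1.*2%:R.
Proof.
move=> w; have [_ _ _ He _] := w; rewrite -(sum_deg_edges _ He) mulr_suml.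
apply: eq_bigr => v _; rewrite (pi_degE _ _ w) -mulr_natl; ring.
Qed.

Lemma sum_pi_deg_eq (R : realType) t g v (F : nat -> R) : wf t g ->
  (v < nv g)%N ->
  \sum_(u < nv g) pi_deg R g u * F (u == v :> nat) =
  (1 - pi_deg R g v) * F 0%N + pi_deg R g v * F 1%N.
Proof.
move=> w vg; have := sum_pi_deg R w.
rewrite (bigD1 (Ordinal vg)) //= => <-.
rewrite (bigD1 (Ordinal vg)) //= eqxx addrC; congr (_ + _).
rewrite [pi_deg R g v + _]addrC addrK mulr_suml; apply: eq_bigr => i iv.
rewrite (_ : i == v :> nat = false) //.
by apply: contraNF iv => /eqP ei; apply/eqP/val_inj.
Qed.

(* The conditional expectation of [h G_{t+1}] given [G_t = g], when [ph t] is the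
   probability of a vertex-step at time [t]; [run ph k t h g] is that of
   [h G_{t+k}]. *)
Definition step (R : realType) (ph : nat -> R) (t : nat)
    (h : multigraph -> R) (g : multigraph) : R :=
  ph t.+1 * \sum_(v < nv g) pi_deg R g v * h (add_vertex g v) +
  (1 - ph t.+1) * \sum_(v < nv g) \sum_(w < nv g)
     pi_deg R g v * pi_deg R g w * h (add_edge g v w).

Fixpoint run (R : realType) (ph : nat -> R) (k t : nat)
    (h : multigraph -> R) (g : multigraph) : R :=
  if k is k'.+1 then step ph t (run ph k' t.+1 h) g else h g.

(** Most inequalities below hold only on graphs that the process can reach; such invariants let them
    pass under [step] and [run]. *)
Definition inherited (I : nat -> multigraph -> Prop) : Prop :=
  forall t g, I t g ->
    (forall v, (v < nv g)%N -> I t.+1 (add_vertex g v)) /\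
    (forall v w, (v < nv g)%N -> (w < nv g)%N -> I t.+1 (add_edge g v w)).

Lemma wf_inherited : inherited wf.
Proof.
move=> t g w; split=> [v vg|v v' vg v'g]; first exact: wf_add_vertex.
exact: wf_add_edge.
Qed.

Lemma wf_nv_ge_inherited n : inherited (fun t g => wf t g /\ (n <= nv g)%N).
Proof.
move=> t g [w ng]; have [wv we] := wf_inherited w; split=> [v vg|v v' vg v'g].
  by split; [exact: wv|exact: leqW].
by split; [exact: we|].
Qed.

Section Chain.
Variables (R : realType) (ph : nat -> R).
Hypothesis ph01 : forall t, 0 <= ph t.+1 <= 1.

Lemma step_ge t (h h' : multigraph -> R) g :
  (forall v, (v < nv g)%N -> h (add_vertex g v) <= h' (add_vertex g v)) ->
  (forall v w, (v < nv g)%N -> (w < nv g)%N ->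
     h (add_edge g v w) <= h' (add_edge g v w)) ->
  step ph t h g <= step ph t h' g.
Proof.
have /andP[f0 f1] := ph01 t => Hv He; apply: lerD.
  by apply: ler_wpM2l => //; apply: ler_sum => v _; rewrite ler_wpM2l ?pi_deg_ge0 ?Hv.
apply: ler_wpM2l; first by rewrite subr_ge0.
apply: ler_sum => v _; apply: ler_sum => w _.
by rewrite ler_wpM2l ?mulr_ge0 ?pi_deg_ge0 ?He.
Qed.

Lemma step_mono (I : nat -> multigraph -> Prop) t (h h' : multigraph -> R) g :
  inherited I -> I t g -> (forall g', I t.+1 g' -> h g' <= h' g') ->
  step ph t h g <= step ph t h' g.
Proof.
by move=> HI /HI[Iv Ie] H; apply: step_ge => *; apply: H; [apply: Iv|apply: Ie].
Qed.

Lemma run_mono (I : nat -> multigraph -> Prop) k t (h h' : multigraph -> R) g :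
  inherited I -> I t g -> (forall g', I (t + k)%N g' -> h g' <= h' g') ->
  run ph k t h g <= run ph k t h' g.
Proof.
move=> HI; elim: k t g => [|k IH] t g It H /=; first by apply: H; rewrite addn0.
apply: (step_mono HI It) => g' Ig'; apply: IH => // g'' I''.
by apply: H; rewrite addnS.
Qed.

Lemma stepD t (h h' : multigraph -> R) g :
  step ph t (fun x => h x + h' x) g = step ph t h g + step ph t h' g.
Proof.
rewrite /step; under eq_bigr do rewrite mulrDr.
rewrite big_split /=.
under [X in _ + _ * X = _]eq_bigr do
  (under eq_bigr do rewrite mulrDr; rewrite big_split /=).
rewrite big_split /=; ring.
Qed.

Lemma stepZ t c (h : multigraph -> R) g :
  step ph t (fun x => c * h x) g = c * step ph t h g.
Proof.
rewrite /step; under eq_bigr do rewrite mulrCA.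
rewrite -mulr_sumr.
under [X in _ + _ * X = _]eq_bigr do
  (under eq_bigr do rewrite mulrCA; rewrite -mulr_sumr).
rewrite -mulr_sumr; ring.
Qed.

Lemma step_cst t c g : wf t g -> step ph t (fun=> c) g = c.
Proof.
move=> w; rewrite /step -mulr_suml (sum_pi_deg _ w).
under [X in _ + _ * X = _]eq_bigr do rewrite -mulr_suml -mulr_sumr (sum_pi_deg _ w) mulr1.
rewrite -mulr_suml (sum_pi_deg _ w); ring.
Qed.

Lemma step_ext t (h h' : multigraph -> R) g :
  h =1 h' -> step ph t h g = step ph t h' g.
Proof. by move=> /funext ->. Qed.

Lemma runD k t (h h' : multigraph -> R) g :
  run ph k t (fun x => h x + h' x) g = run ph k t h g + run ph k t h' g.
Proof.
elim: k t g => [//|k IH] t g /=.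
by rewrite -stepD; apply: step_ext => x; exact: IH.
Qed.

Lemma runZ k t c (h : multigraph -> R) g :
  run ph k t (fun x => c * h x) g = c * run ph k t h g.
Proof.
elim: k t g => [//|k IH] t g /=.
by rewrite -stepZ; apply: step_ext => x; exact: IH.
Qed.

Lemma run_cst k t c g : wf t g -> run ph k t (fun=> c) g = c.
Proof.
elim: k t g => [//|k IH] t g w /=; rewrite -[RHS](step_cst c w).
have [wv we] := wf_inherited w.
apply/eqP; rewrite eq_le; apply/andP; split; apply: step_ge => *;
  by rewrite IH //; first [exact: wv|exact: we].
Qed.

Lemma run_sum (J : Type) (r : seq J) k t (h : J -> multigraph -> R) g :
  wf t g ->
  run ph k t (fun x => \sum_(i <- r) h i x) g =
  \sum_(i <- r) run ph k t (h i) g.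
Proof.
move=> w; elim: r => [|i r IH].
  rewrite big_nil -[RHS](run_cst k 0 w); congr run.
  by apply/funext => x; rewrite big_nil.
rewrite big_cons -IH -runD; congr run.
by apply/funext => x; rewrite big_cons.
Qed.

Lemma run_add j k t (h : multigraph -> R) g :
  run ph (j + k) t h g = run ph j t (run ph k (t + j) h) g.
Proof.
elim: j t g => [|j IH] t g; first by rewrite add0n addn0.
rewrite addSn /=; apply: step_ext => x; rewrite IH; congr run.
by rewrite addSnnS.
Qed.

Lemma runSr k t (h : multigraph -> R) g :
  run ph k.+1 t h g = run ph k t (step ph (t + k) h) g.
Proof. by rewrite -addn1 run_add. Qed.

(** [V] depends on time so that it can carry the rate: a power of [r + 1] for the negative moment of
    a degree, a power of [1 - kappa] for non-adjacency. *)
Lemma run_supermartingale (I : nat -> multigraph -> Prop)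
    (V : nat -> multigraph -> R) k t g :
  inherited I ->
  (forall r g', (t <= r < t + k)%N -> I r g' -> step ph r (V r.+1) g' <= V r g') ->
  I t g -> run ph k t (V (t + k)%N) g <= V t g.
Proof.
move=> HI; elim: k t g => [|k IH] t g HV It /=; first by rewrite addn0.
apply: (le_trans _ (HV t g _ It)); last by rewrite leqnn addnS leq_addr.
apply: (step_mono HI It) => g' Ig'; rewrite addnS -addSn; apply: IH => // r g''.
by move=> /andP[a b]; apply: HV; rewrite (ltnW a) addnS -addSn.
Qed.

Lemma run_markov k t (a : R) (h : multigraph -> R) g : wf t g -> 0 < a ->
  (forall g', wf (t + k) g' -> 0 <= h g') ->
  run ph k t (fun x => (a <= h x)%R%:R) g <= run ph k t h g / a.
Proof.
move=> w a0 h0; rewrite ler_pdivlMr // mulrC -runZ.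
apply: (run_mono wf_inherited w) => g' w'.
by case: (leP a (h g')) => H; rewrite /= ?mulr1 ?mulr0 ?h0.

Qed.

End Chain.

(** * Law of the graph at a fixed time *)

(** The union is countable, a graph being coded by the pair of its fields. *)
Lemma measurable_exists_multigraph (d : measure_display) (T : measurableType d)
    (F : multigraph -> set T) :
  (forall h, measurable (F h)) -> measurable [set omega | exists h, F h omega].
Proof.
move=> mF; pose F' n : set T :=
  if unpickle n is Some (a, s) then F (Multigraph a s) else set0.
rewrite (_ : [set _ | _] = \bigcup_n F' n).
  apply: bigcupT_measurable => n; rewrite /F'.
  by case: (unpickle n : option (nat * seq (nat * nat))) => [[a s]|].
apply/seteqP; split=> [x [[a s] Fx]|x [n _]].
  by exists (pickle (a, s)) => //; rewrite /F' pickleK.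
rewrite /F'; case: (unpickle n : option (nat * seq (nat * nat))) => [[a s]|//].
by exists (Multigraph a s).
Qed.

Section Prob.
Variables (R : realType) (d : measure_display) (T : measurableType d).
Variable P : probability T R.

Definition prob (A : set T) : R := fine (P A).

Lemma probE A : measurable A -> P A = (prob A)%:E.
Proof. by move=> mA; rewrite fineK // fin_num_measure. Qed.

Lemma prob_ge0 A : 0 <= prob A.
Proof. exact: fine_ge0. Qed.

Lemma prob_le A B : measurable A -> measurable B -> A `<=` B -> prob A <= prob B.
Proof.
move=> mA mB AB; rewrite -lee_fin -!probE //.
by apply: le_measure; rewrite ?inE.
Qed.

Lemma probD A B : measurable A -> measurable B ->
  prob A = prob (A `&` B) + prob (A `\` B).
Proof.
move=> mA mB; apply/EFin_inj; have mI := measurableI _ _ mA mB.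
have mD := measurableD mA mB.
by rewrite EFinD -!probE // addeC; exact: measureDI.
Qed.

Lemma sum_prob_le (J : eqType) (r : seq J) (A : J -> set T) (B : set T) :
  uniq r -> measurable B -> (forall i, measurable (A i)) ->
  (forall i, A i `<=` B) -> (forall i j x, A i x -> A j x -> i = j) ->
  \sum_(i <- r) prob (A i) <= prob B.
Proof.
move=> ur mB mA AB dA.
have : forall i, i \in r -> A i `<=` B by move=> i _; exact: AB.
move=> {AB}; elim: r B mB ur => [|i r IH] B mB /=.
  by rewrite big_nil prob_ge0.
move=> /andP[ir ur] AB; rewrite big_cons (probD mB (mA i)).
apply: lerD; first by apply: prob_le => // [|x Ax];
  [exact: measurableI|split=> //; apply: AB Ax; rewrite inE eqxx].
apply: IH => // [|j jr x Ax]; first exact: measurableD.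
split; first by apply: AB Ax; rewrite inE jr orbT.
by move=> Aix; rewrite (dA _ _ _ Aix Ax) jr in ir.
Qed.

End Prob.

Definition one_step (g g' : multigraph) : Prop :=
  (exists2 v, (v < nv g)%N & g' = add_vertex g v) \/
  (exists v w, [/\ (v < nv g)%N, (w < nv g)%N & g' = add_edge g v w]).

Lemma add_vertex_inj g : injective (add_vertex g).
Proof. by move=> v w [] /rcons_inj[]. Qed.

Lemma add_edge_inj g v w v' w' :
  add_edge g v w = add_edge g v' w' -> (v, w) = (v', w').
Proof. by case=> /rcons_inj[-> ->]. Qed.

Section Bridge.
Variables (R : realType) (d : measure_display) (T : measurableType d).
Variables (P : probability T R) (f : R -> R).
Variables (Z : nat -> T -> bool) (G : nat -> T -> multigraph).
Hypothesis proc : graph_process P f Z G.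
Hypothesis f01 : forall t : nat, 0 <= f t.+1%:R <= 1.

Let ph (n : nat) : R := f n%:R.

Lemma measurable_process_pred t (Q : multigraph -> Prop) :
  measurable [set omega | Q (G t omega)].
Proof.
rewrite (_ : [set _ | _] = [set omega | exists h, Q h /\ G t omega = h]).
  apply: measurable_exists_multigraph => h.
  have [Qh|Qh] := pselect (Q h).
    rewrite (_ : (fun _ => _) = [set omega | G t omega = h]).
      exact: (gp_measurable_G proc).
    by apply/seteqP; split=> x /=; [case|].
  rewrite (_ : (fun _ => _) = set0); first exact: measurable0.
  by apply/seteqP; split=> x //= [].
by apply/seteqP; split=> x /=; [exists (G t x)|case=> h [Qh ->]].
Qed.

Lemma measurable_process_rel s t (Q : multigraph -> multigraph -> Prop) :
  measurable [set omega | Q (G s omega) (G t omega)].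
Proof.
rewrite (_ : [set _ | _] =
  [set omega | exists h, G s omega = h /\ Q h (G t omega)]).
  apply: measurable_exists_multigraph => h.
  rewrite (_ : (fun _ => _) =
    [set omega | G s omega = h] `&` [set omega | Q h (G t omega)]).
    apply: measurableI; first exact: (gp_measurable_G proc).
    exact: (measurable_process_pred t (Q h)).
  by apply/seteqP; split=> x.
by apply/seteqP; split=> x /=; [exists (G s x)|case=> h [->]].
Qed.

Lemma measurable_forall_nat (Q : nat -> Prop) (A : nat -> set T) :
  (forall s, measurable (A s)) ->
  measurable [set omega | forall s, Q s -> A s omega].
Proof.
move=> mA; rewrite (_ : [set _ | _] =
  \bigcap_s (if `[< Q s >] then A s else setT)).
  by apply: bigcapT_measurable => s; case: asboolP => // _; exact: measurableT.
apply/seteqP; split=> [x H s _|x H s Qs].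
  by case: asboolP => // Qs; exact: H.
by have := H s Logic.I; case: asboolP.
Qed.

Lemma measurable_past t z g : measurable (past Z G t z g).
Proof.
rewrite (_ : past Z G t z g =
  [set omega | forall s, (1 <= s <= t)%N -> [set omega | Z s omega = z s] omega]
  `&` [set omega | forall s, (s <= t)%N -> [set omega | G s omega = g s] omega]).
  apply: measurableI; apply: measurable_forall_nat => s.
    exact: (gp_measurable_Z proc).
  exact: (gp_measurable_G proc).
by apply/seteqP; split.
Qed.

Lemma measurable_one_steps m :
  measurable [set omega | forall s, (s < m)%N -> one_step (G s omega) (G s.+1 omega)].
Proof.
apply: (@measurable_forall_nat (fun s => (s < m)%N)
  (fun s => [set omega | one_step (G s omega) (G s.+1 omega)])) => s.
exact: measurable_process_rel.
Qed.

(** Legality of the steps is part of the event because the lower bound for its probability sums over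
    legal continuations only; with [B] always true, the same bound shows that illegal steps have
    probability 0. *)
Let good m (B : pred multigraph) :=
  [set omega | forall s, (s < m)%N -> one_step (G s omega) (G s.+1 omega)] `&`
  [set omega | B (G m omega)].

Lemma measurable_good m B : measurable (good m B).
Proof.
apply: measurableI; first exact: measurable_one_steps.
exact: (measurable_process_pred m (fun h => B h)).
Qed.

Let upd (X : Type) (z : nat -> X) t (b : X) s := if s == t then b else z s.

Lemma updE (X : Type) (z : nat -> X) t b : upd z t b t = b.
Proof. by rewrite /upd eqxx. Qed.

Lemma past_upd t z g b h :
  past Z G t z g `&` [set omega | Z t.+1 omega = b]
    `&` [set omega | G t.+1 omega = h] =
  past Z G t.+1 (upd z t.+1 b) (upd g t.+1 h).
Proof.
apply/seteqP; split=> x /=.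
  move=> [[[Hz Hg] Zb] Gh]; split=> s.
    move=> /andP[s1]; rewrite leq_eqVlt /upd => /predU1P[->|st].
      by rewrite eqxx.
    by rewrite ltn_eqF //; apply: Hz; rewrite s1.
  rewrite leq_eqVlt /upd => /predU1P[->|st]; first by rewrite eqxx.
  by rewrite ltn_eqF //; apply: Hg.
move=> [Hz Hg]; have := Hz t.+1; rewrite /upd eqxx /= leqnn => Hz1.
have := Hg t.+1; rewrite /upd eqxx leqnn => Hg1.
split; last exact: Hg1.
split; last exact: Hz1.
split.
  move=> s /andP[s1 st]; have := Hz s; rewrite /upd ltn_eqF ?ltnS //; apply.
  by rewrite s1 leqW.
by move=> s st; have := Hg s; rewrite /upd ltn_eqF ?ltnS //; apply; rewrite leqW.
Qed.

Lemma prob_vertex_step t z g v : (v < nv (g t))%N ->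
  prob P (past Z G t.+1 (upd z t.+1 true) (upd g t.+1 (add_vertex (g t) v))) =
  prob P (past Z G t z g) * (ph t.+1 * pi_deg R (g t) v).
Proof.
move=> vg; have mpast := measurable_past t z g.
rewrite -past_upd /prob (gp_vertex_step proc) // (gp_bernoulli proc).
by rewrite (probE P mpast) /= mulrA.
Qed.

Lemma prob_edge_step t z g v w : (v < nv (g t))%N -> (w < nv (g t))%N ->
  prob P (past Z G t.+1 (upd z t.+1 false) (upd g t.+1 (add_edge (g t) v w))) =
  prob P (past Z G t z g) *
    ((1 - ph t.+1) * (pi_deg R (g t) v * pi_deg R (g t) w)).
Proof.
move=> vg wg; have mpast := measurable_past t z g.
rewrite -past_upd /prob (gp_edge_step proc) //.
have mZ b := gp_measurable_Z proc t.+1 b.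
have mf := measurableI _ _ mpast (mZ false).
have -> : P (past Z G t z g `&` [set omega | Z t.+1 omega = false]) =
    (prob P (past Z G t z g) * (1 - ph t.+1))%:E.
  rewrite (probE P mf); congr _%:E.
  rewrite mulrBr mulr1 [X in X - _](probD P mpast (mZ true)).
  rewrite {2}/prob (gp_bernoulli proc) (probE P mpast) /= addrC addKr.
  congr prob; apply/seteqP; split=> x /= [H]; first by move=> ->.
  by case: (Z t.+1 x).
by rewrite /= -mulrA.
Qed.

(* Conditioning is only available on full pasts, so the induction runs forward
   from an arbitrary one, and the inequality is that of a union of disjoint
   continuations; equality is recovered by taking complements. *)
Lemma run_le_prob_past k t z g (B : pred multigraph) :
  (forall s, (s < t)%N -> one_step (g s) (g s.+1)) ->
  prob P (past Z G t z g) * run ph k t (fun x => (B x)%:R) (g t) <=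
  prob P (past Z G t z g `&` good (t + k)%N B).
Proof.
elim: k t z g => [|k IH] t z g Hg.
  rewrite /= addn0; case: (boolP (B (g t))) => Bg; last first.
    by rewrite mulr0 prob_ge0.
  rewrite mulr1; apply: prob_le.
  - exact: measurable_past.
  - by apply: measurableI; [exact: measurable_past|exact: measurable_good].
  move=> x Hx; have [_ Gx] := Hx; split=> //; split=> /=.
    by move=> s st; rewrite !Gx ?(ltnW st) //; exact: Hg.
  by rewrite Gx.
have mpast := measurable_past t z g.
have mgood := measurable_good (t + k.+1) B.
have mZ b := gp_measurable_Z proc t.+1 b.
(* Splitting on [Z t.+1] matches the two terms of [step]; in each, the possible choices of endpoints
   give disjoint longer pasts. *)
rewrite [leRHS](probD P (measurableI _ _ mpast mgood) (mZ true)).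
rewrite [run _ _ _ _ _]/= /step mulrDr.
apply: lerD.
  rewrite !mulr_sumr.
  pose A (v : 'I_(nv (g t))) :=
    past Z G t.+1 (upd z t.+1 true) (upd g t.+1 (add_vertex (g t) v))
      `&` good (t.+1 + k)%N B.
  apply: (@le_trans _ _ (\sum_v prob P (A v))).
    apply: ler_sum => v _.
    have := IH t.+1 (upd z t.+1 true) (upd g t.+1 (add_vertex (g t) v)).
    rewrite prob_vertex_step // updE => H.
    rewrite !mulrA; rewrite !mulrA in H; apply: H => s.
    rewrite ltnS /upd eqSS leq_eqVlt => /predU1P[->|st].
      by rewrite eqxx ltn_eqF //; left; exists v.
    by rewrite !ltn_eqF ?ltnS ?(ltnW st) //; exact: Hg.
  apply: sum_prob_le.
  - exact: index_enum_uniq.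
  - by apply: measurableI => //; apply: measurableI.
  - by move=> v; apply: measurableI; [exact: measurable_past|exact: measurable_good].
  - move=> v x; rewrite /A addSnnS -past_upd => -[[[]]] //.
  - move=> v w x; rewrite /A -!past_upd => -[[_ /= ->] _] [[_ /= /add_vertex_inj E] _].
    exact/val_inj.
rewrite !mulr_sumr.
under eq_bigr do rewrite !mulr_sumr.
rewrite pair_big /=.
pose A (v : 'I_(nv (g t)) * 'I_(nv (g t))) :=
  past Z G t.+1 (upd z t.+1 false) (upd g t.+1 (add_edge (g t) v.1 v.2))
    `&` good (t.+1 + k)%N B.
apply: (@le_trans _ _ (\sum_v prob P (A v))).
  apply: ler_sum => -[v w] _.
  have := IH t.+1 (upd z t.+1 false) (upd g t.+1 (add_edge (g t) v w)).
  rewrite prob_edge_step // updE => H.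
  rewrite !mulrA; rewrite !mulrA in H; apply: H => s.
  rewrite ltnS /upd eqSS leq_eqVlt => /predU1P[->|st].
    by rewrite eqxx ltn_eqF //; right; exists v, w.
  by rewrite !ltn_eqF ?ltnS ?(ltnW st) //; exact: Hg.
apply: sum_prob_le.
- exact: index_enum_uniq.
- by apply: measurableD => //; apply: measurableI.
- by move=> v; apply: measurableI; [exact: measurable_past|exact: measurable_good].
- move=> v x; rewrite /A addSnnS -past_upd => -[[[Hp /= ->]]] //.
- move=> [v v'] [w w'] x; rewrite /A -!past_upd.
  move=> -[[_ /= ->] _] [[_ /= /add_edge_inj[E E']] _].
  by congr pair; exact/val_inj.
Qed.

Lemma run_le_prob_good k (B : pred multigraph) :
  run ph k 0 (fun x => (B x)%:R) one_loop <= prob P (good k B).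
Proof.
have := @run_le_prob_past k 0 (fun=> true) (fun=> one_loop) B.
have -> : past Z G 0 (fun=> true) (fun=> one_loop) = setT.
  apply/seteqP; split=> // x _; split=> s; first by case: s.
  by rewrite leqn0 => /eqP ->; rewrite (gp_init proc).
by rewrite setTI /prob probability_setT mul1r; apply.
Qed.

Lemma prob_le_run k (B : pred multigraph) :
  (P [set omega | B (G k omega)] <=
   (run ph k 0 (fun x => (B x)%:R) one_loop)%:E)%E.
Proof.
have mB := measurable_process_pred k (fun h => B h).
rewrite (probE P mB) lee_fin.
have H : prob P [set omega | B (G k omega)] + prob P (good k (fun x => ~~ B x)) <= 1.
  have -> : 1 = prob P setT by rewrite /prob probability_setT.
  have mT := @measurableT _ T.
  rewrite (probD P mT mB) setTI lerD2l.
  apply: prob_le; [exact: measurable_good|exact: measurableD|].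
  by move=> x [_ /= Bx]; split=> //; apply/negP.
have := run_le_prob_good k (fun x => ~~ B x).
have w0 := wf_one_loop; have := @run_cst R ph f01 k 0 1 _ w0.
rewrite (_ : (fun=> 1) = fun x => (B x)%:R + (~~ B x)%:R); last first.
  by apply/funext => x; case: (B x); rewrite ?addr0 ?add0r.
rewrite runD => E HB; move: H; lra.
Qed.

(** The legal paths already carry mass [run] of the constant 1, which is 1. *)
Lemma ae_one_step : {ae P, forall omega, forall t, one_step (G t omega) (G t.+1 omega)}.
Proof.
apply/ae_foralln => t; have mE := measurable_process_rel t t.+1 one_step.
exists (~` [set omega | one_step (G t omega) (G t.+1 omega)]); split; [exact: measurableC| |by []].
apply: etrans (probability_setC P mE) _; rewrite (probE P mE) -EFinB; congr _%:E.
have H1 : prob P [set omega | one_step (G t omega) (G t.+1 omega)] <= 1.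
  by rewrite -lee_fin -probE //; exact: probability_le1.
have := run_le_prob_good t.+1 xpredT.
have w0 := wf_one_loop; rewrite (@run_cst R ph f01 _ 0 1 _ w0) => H.
have : prob P (good t.+1 xpredT) <= prob P [set omega | one_step (G t omega) (G t.+1 omega)].
  apply: prob_le => //; first exact: measurable_good.
  by move=> x [/= Hx _]; exact: Hx.
move: H H1; lra.
Qed.

End Bridge.

(** * Triangles and cherries of a fixed graph *)

(** Cauchy-Schwarz against the indicator of [B], from [2 x y <= x^2 + y^2] summed over all pairs. *)
Lemma sqr_sum_le_card (I : finType) (B : pred I) (x : I -> nat) :
  ((\sum_(i | B i) x i) ^ 2 <= #|B| * \sum_(i | B i) x i ^ 2)%N.
Proof.
have E : ((\sum_(i | B i) x i) ^ 2 = \sum_(i | B i) \sum_(j | B j) x i * x j)%N.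
  rewrite -mulnn big_distrl /=; apply: eq_bigr => i _; exact: big_distrr.
rewrite -(leq_pmul2l (m := 2)) // E big_distrr /=.
apply: (@leq_trans (\sum_(i | B i) \sum_(j | B j) (x i ^ 2 + x j ^ 2))).
  apply: leq_sum => i _; rewrite big_distrr /=; apply: leq_sum => j _.
  exact: nat_Cauchy.
under eq_bigr do rewrite big_split /= sum_nat_const.
rewrite big_split /= sum_nat_const -big_distrr /=; lia.
Qed.

(* A discrete Loomis-Whitney inequality: the inner sum is at most the A-degree
   of v and at most the C-degree of w, so its square is at most their product. *)
Lemma loomis_whitney (V : finType) (A B C : rel V) :
  ((\sum_v \sum_w B v w * \sum_u A u v * C u w) ^ 2 <=
   (\sum_u \sum_v A u v) * (\sum_v \sum_w B v w) * (\sum_u \sum_w C u w))%N.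
Proof.
pose x (p : V * V) := (\sum_u A u p.1 * C u p.2)%N.
rewrite pair_big /=.
have -> : (\sum_p B p.1 p.2 * \sum_u A u p.1 * C u p.2 =
    \sum_(p | B p.1 p.2) x p)%N.
  by rewrite [RHS]big_mkcond; apply: eq_bigr => p _; case: (B _ _); rewrite ?mul1n.
apply: leq_trans (sqr_sum_le_card _ _) _.
have -> : (\sum_v \sum_w B v w = #|[pred p | B p.1 p.2]|)%N.
  by rewrite pair_big /= -sum1_card [RHS]big_mkcond /=; apply: eq_bigr => p _; rewrite inE; case: (B _ _).
rewrite -[X in (_ <= X)%N]mulnA mulnCA leq_mul2l; apply/orP; right.
rewrite [X in (_ <= X * _)%N]exchange_big [X in (_ <= _ * X)%N]exchange_big /=.
rewrite big_distrl /=.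
under [X in (_ <= X)%N]eq_bigr do rewrite big_distrr /=.
rewrite [X in (_ <= X)%N]pair_big big_mkcond /=.
apply: leq_sum => p _; case: (B _ _) => //.
rewrite -mulnn leq_mul //; apply: leq_sum => u _.
  by case: (A _ _); case: (C _ _).
by case: (A _ _); case: (C _ _).
Qed.

(** Ordered pairs are counted, so this is twice the number of edges of the underlying simple graph;
    constant factors vanish in the limit. *)
Definition adjacencies (g : multigraph) : nat :=
  (\sum_(u < nv g) \sum_(v < nv g) adj g u v)%N.

Definition subsimple (g g' : multigraph) : Prop :=
  (nv g <= nv g')%N /\ (forall u v, adj g u v -> adj g' u v).

Lemma subsimple_refl g : subsimple g g.
Proof. by []. Qed.

Lemma subsimple_trans g1 g2 g3 :
  subsimple g1 g2 -> subsimple g2 g3 -> subsimple g1 g3.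
Proof.
move=> [n12 a12] [n23 a23]; split; first exact: leq_trans n12 n23.
by move=> u v /a12/a23.
Qed.

Lemma one_step_subsimple g g' : one_step g g' -> subsimple g g'.
Proof.
have H e u v : adj g u v ->
    (u != v) && (((u, v) \in rcons (edges g) e) || ((v, u) \in rcons (edges g) e)).
  rewrite /adj => /andP[->]; rewrite !mem_rcons !inE.
  by move=> /orP[] ->; rewrite !orbT.
case=> [[v vg ->]|[v [w [vg wg ->]]]]; split=> //=; try exact: leqnSn.
- by move=> u u'; exact: H.
- by move=> u u'; exact: H.
Qed.

Lemma adjacencies_mono g g' : subsimple g g' -> (adjacencies g <= adjacencies g')%N.
Proof.
move=> [n a]; rewrite /adjacencies.
rewrite (big_ord_widen (nv g') (fun u => \sum_(v < nv g) adj g u v)%N n) /=.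
rewrite big_mkcond /=; apply: leq_sum => u _; case: ifP => // _.
rewrite (big_ord_widen (nv g') (fun v => adj g u v : nat) n) /=.
rewrite big_mkcond /=; apply: leq_sum => v _; case: ifP => // _.
by have := a u v; case: (adj g u v) => // ->.
Qed.

Lemma triangles_mono g g' : subsimple g g' -> (triangles g <= triangles g')%N.
Proof.
move=> [n a]; pose i := widen_ord n.
have ii : injective i by move=> x y /(congr1 val) /= E; exact/val_inj.
rewrite /triangles -(card_imset _ (imset_inj ii)); apply: subset_leq_card.
apply/fintype.subsetP => _ /imsetP[A HA ->]; move: HA; rewrite !inE card_imset //.
move=> /andP[-> /forall_inP H] /=; apply/forall_inP => _ /imsetP[u uA ->].
apply/forall_inP => _ /imsetP[v vA ->]; apply/implyP => uv.
apply: a; have /forall_inP/(_ v vA)/implyP := H u uA; apply.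
by apply: contraNneq uv => ->.
Qed.

Lemma cherries_mono g g' : subsimple g g' -> (cherries g <= cherries g')%N.
Proof.
move=> [n a]; pose i := widen_ord n.
have ii : injective i by move=> x y /(congr1 val) /= E; exact/val_inj.
pose j (p : 'I_(nv g) * {set 'I_(nv g)}) := (i p.1, i @: p.2).
have ij : injective j.
  by move=> [x A] [y B] [/val_inj-> /(imset_inj ii) ->].
rewrite /cherries -(card_imset _ ij); apply: subset_leq_card.
apply/fintype.subsetP => _ /imsetP[[x A] HA ->]; move: HA; rewrite !inE /= card_imset //.
move=> /andP[-> /forall_inP H] /=; apply/forall_inP => _ /imsetP[u uA ->].
by apply: a; exact: H.
Qed.

Lemma cards3_ex (V : finType) (A : {set V}) : #|A| == 3 ->
  exists u v w, [/\ u != v, u != w, v != w & A = [set u; v; w]%SET].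
Proof.
move=> A3; have /card_gt0P[u uA] : (0 < #|A|)%N by rewrite (eqP A3).
move: A3; rewrite (cardsD1 u) uA eqSS => /cards2P[v [w [vw E]]].
have : v \in A :\ u by rewrite E !inE eqxx.
have : w \in A :\ u by rewrite E !inE eqxx orbT.
rewrite !inE => /andP[wu _] /andP[vu _].
exists u, v, w; split; rewrite 1?eq_sym // 1?[w == v]eq_sym //.
by rewrite -finset.setUA -E finset.setD1K.
Qed.

(** Loomis-Whitney with all three relations equal to adjacency; each triangle is the set of entries
    of some ordered adjacent triple, so ordered triples are at least as many. *)
Lemma triangles_le g : (triangles g ^ 2 <= adjacencies g ^ 3)%N.
Proof.
pose V := 'I_(nv g); pose e : rel V := fun u v => adj g u v.
apply: leq_trans (_ : (\sum_v \sum_w e v w * \sum_u e u v * e u w) ^ 2 <= _)%N; last first.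
  by apply: leq_trans (loomis_whitney e e e) _; rewrite !expnS expn0 muln1 mulnA.
rewrite leq_exp2r //.
pose S := [set p : V * V * V | [&& e p.1.1 p.1.2, e p.1.1 p.2 & e p.1.2 p.2]]%SET.
apply: (@leq_trans #|S|).
  apply: leq_trans (leq_imset_card (fun p : V * V * V => [set p.1.1; p.1.2; p.2]%SET) S).
  apply: subset_leq_card; apply/fintype.subsetP => A; rewrite inE => /andP[/cards3_ex].
  move=> [u [v [w [uv uw vw ->]]]] /forall_inP H; apply/imsetP; exists (u, v, w) => //.
  have adjA x y : x \in [set u; v; w]%SET -> y \in [set u; v; w]%SET -> x != y -> e x y.
    by move=> xA yA xy; have /forall_inP/(_ y yA)/implyP/(_ xy) := H x xA.
  by rewrite inE /= !adjA // !inE eqxx ?orbT.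
rewrite -sum1_card big_mkcond /=.
(* The summation order becomes [v], [w], [u], as in [loomis_whitney]. *)
rewrite (reindex (fun p : V * V * V => (p.2, p.1.1, p.1.2))) /=; last first.
  by exists (fun p : V * V * V => (p.1.2, p.2, p.1.1)) => [[[x y] z]|[[x y] z]] _.
under [X in (_ <= X)%N]eq_bigr do under eq_bigr do rewrite big_distrr.
rewrite pair_big pair_big /=; apply: leq_sum => -[[v w] u] _ /=.
by rewrite inE /=; case: (e u v); case: (e u w); case: (e v w).
Qed.

(** A cherry is determined by an adjacent pair (its centre and one end) and a further vertex. *)
Lemma cherries_le g : (cherries g <= adjacencies g * nv g)%N.
Proof.
pose V := 'I_(nv g); pose e : rel V := fun u v => adj g u v.
pose S := [set p : V * V * V | e p.1.1 p.1.2]%SET.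
apply: (@leq_trans #|S|).
  apply: leq_trans (leq_imset_card (fun p : V * V * V => (p.1.1, [set p.1.2; p.2]%SET)) S).
  apply: subset_leq_card; apply/fintype.subsetP => -[c A]; rewrite inE /= => /andP[/cards2P].
  move=> [u [v [uv ->]]] /forall_inP H; apply/imsetP; exists (c, u, v) => //.
  by rewrite inE; apply: H; rewrite !inE eqxx.
rewrite -sum1_card big_mkcond /=.
rewrite (_ : (\sum_p _ = \sum_q \sum_w if (q, w) \in S then 1 else 0)%N); last first.
  by rewrite pair_big; apply: eq_bigr => -[q w] _.
rewrite /adjacencies [X in (_ <= X * _)%N]pair_big big_distrl /=.
apply: leq_sum => -[u v] _ /=; rewrite -[X in (_ * X)%N]card_ord -sum1_card big_distrr /=.
by apply: leq_sum => w _; rewrite inE /= muln1 /e; case: (adj g u v).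
Qed.

Lemma triangles_ge g (A : {set 'I_(nv g)}) :
  (forall u v, u \in A -> v \in A -> u != v -> adj g u v) ->
  ('C(#|A|, 3) <= triangles g)%N.
Proof.
move=> H; rewrite -cards_draws -[X in (X <= _)%N]cardsE /triangles.
rewrite cardsE; apply: subset_leq_card; apply/fintype.subsetP => B.
rewrite !inE => /andP[/fintype.subsetP BA ->] /=; apply/forall_inP => u uB.
by apply/forall_inP => v vB; apply/implyP; apply: H; exact: BA.
Qed.

Lemma cherries_ge g (c : 'I_(nv g)) (A : {set 'I_(nv g)}) :
  (forall u, u \in A -> adj g c u) -> ('C(#|A|, 2) <= cherries g)%N.
Proof.
move=> H; rewrite -cards_draws.
have ic : injective (fun B : {set 'I_(nv g)} => (c, B)) by move=> B B' [].
rewrite -(card_imset _ ic); apply: subset_leq_card; apply/fintype.subsetP => p.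
move=> /imsetP[B]; rewrite !inE => /andP[/fintype.subsetP BA HB] -> /=; rewrite HB /=.
by apply/forall_inP => u uB; apply: H; exact: BA.
Qed.

(** * Powers, sums and regular variation *)

Section RealAux.
Variable R : realType.
Implicit Types (a b x y C : R) (n k : nat).

Lemma powRE x a : 0 < x -> x `^ a = expR (a * ln x).
Proof. by move=> x0; rewrite /powR gt_eqF. Qed.

Lemma powRD_pos x a b : 0 < x -> x `^ (a + b) = x `^ a * x `^ b.
Proof. by move=> x0; apply: powRD; rewrite (gt_eqF x0) implybT. Qed.

Lemma powR_le_factor2 x y a : 0 < x -> 0 < y -> x <= 2 * y -> y <= 2 * x ->
  x `^ a <= 2 `^ `|a| * y `^ a.
Proof.
move=> x0 y0 xy yx; rewrite !powRE // -expRD ler_expR.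
have l1 : ln x <= ln 2 + ln y.
  by rewrite -lnM ?posrE // ler_ln ?posrE // mulr_gt0.
have l2 : ln y <= ln 2 + ln x.
  by rewrite -lnM ?posrE // ler_ln ?posrE // mulr_gt0.
have [a0|a0] := leP 0 a.
  by rewrite ger0_norm // -mulrDr ler_wpM2l.
rewrite ltr0_norm // mulNr -subr_ge0.
have -> : - (a * ln 2) + a * ln y - a * ln x = - a * (ln 2 + ln x - ln y) by ring.
by apply: mulr_ge0; rewrite ?subr_ge0 // oppr_ge0 ltW.
Qed.

Lemma powR_expn x a k : 0 <= x -> (x ^+ k) `^ a = (x `^ a) ^+ k.
Proof.
move=> x0; rewrite -powR_mulrn // -powRrM mulrC powRrM powR_mulrn //.
exact: powR_ge0.
Qed.

Lemma powR2n a k : ((2 ^ k)%N%:R : R) `^ a = (2 `^ a) ^+ k.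
Proof. by rewrite natrX powR_expn. Qed.

Lemma powR_dominates a b C : a < b ->
  exists M, forall x, M <= x -> C * x `^ a <= x `^ b.
Proof.
move=> ab; exists (Num.max 1 (`|C| `^ (b - a)^-1)) => x.
rewrite ge_max => /andP[x1 Cx].
have x0 : 0 < x by apply: lt_le_trans x1.
rewrite -(subrK a b) powRD_pos // ler_wpM2r ?powR_ge0 //.
have e0 : 0 < b - a by rewrite subr_gt0.
apply: le_trans (ler_norm _) _.
rewrite -[X in X <= _](powRr1 (normr_ge0 C)) -(mulVf (lt0r_neq0 e0)) powRrM.
by apply: ge0_ler_powR; rewrite ?nnegrE ?powR_ge0 // ltW.
Qed.

Lemma powR2n_dominates a b C : a < b ->
  \forall k \near \oo, C * ((2 ^ k)%N%:R : R) `^ a <= (2 ^ k)%N%:R `^ b.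
Proof.
move=> ab; have [M HM] := powR_dominates C ab.
near=> k; apply: HM; apply: (@le_trans _ _ k%:R).
  by near: k; exact: nbhs_infty_ger.
by rewrite ler_nat ltnW // ltn_expl.
Unshelve. all: by end_near. Qed.

(** The inequality [expR (y / N) >= y / N] raised to the power [N]. It turns exponential tails into
    powers of any chosen order, the only form in which they are needed. *)
Lemma expRN_le_powR y N : 0 < y -> expR (- y) <= N%:R ^+ N / y ^+ N.
Proof.
move=> y0; rewrite expRN -[leRHS]invrK lef_pV2 ?posrE ?expR_gt0 //; last first.
  by rewrite invr_gt0; case: N => [|N]; rewrite ?expr0 ?divr1 // divr_gt0 ?exprn_gt0.
rewrite invf_div; case: N => [|N].
  by rewrite !expr0 divr1 -[1]expR0 ler_expR ltW.
have N0 : N.+1%:R != 0 :> R by rewrite pnatr_eq0.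
rewrite -expr_div_n -[X in expR X](divfK N0 y).
rewrite expRM_natr; apply: lerXn2r.
- by rewrite nnegrE divr_ge0 // ltW.
- by rewrite nnegrE expR_ge0.
- by apply: le_trans (expR_ge1Dx _); rewrite lerDr ler01.
Qed.

Lemma ln_succ_sub x : 0 < x -> (x + 1)^-1 <= ln (x + 1) - ln x.
Proof.
move=> x0; have y0 : 0 < x + 1 by rewrite addr_gt0.
have -> : ln x = ln (x + 1) + ln (1 - (x + 1)^-1).
  have E : 1 - (x + 1)^-1 = x / (x + 1) by field; rewrite gt_eqF.
  by rewrite E -lnM ?posrE ?divr_gt0 // mulrC divfK // gt_eqF.
rewrite opprD addrA subrr sub0r -lerN2 opprK.
apply: le_ln1Dx; rewrite ltrN2 invf_lt1 // ltrDr //.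
Qed.

(** A telescoping bound that replaces the comparison of the series with an integral. *)
Lemma powRN_succ_le x a : 0 < x -> 0 < a ->
  (x + 1) `^ (- (1 + a)) <= a^-1 * (x `^ (- a) - (x + 1) `^ (- a)).
Proof.
move=> x0 a0; have y0 : 0 < x + 1 by rewrite addr_gt0.
have E : x `^ (- a) = (x + 1) `^ (- a) * expR (a * (ln (x + 1) - ln x)).
  by rewrite !powRE // -expRD; congr expR; ring.
rewrite ler_pdivlMl // E opprD powRD_pos // powR_inv1 ?(ltW y0) //.
set Y := (x + 1) `^ (- a); have Y0 : 0 <= Y by exact: powR_ge0.
have H : a * (x + 1)^-1 <= expR (a * (ln (x + 1) - ln x)) - 1.
  rewrite lerBrDl; apply: le_trans (expR_ge1Dx _).
  by rewrite lerD2l ler_wpM2l ?(ltW a0) // ln_succ_sub.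
have := ler_wpM2l Y0 H; rewrite mulrBr mulr1; apply: le_trans.
by rewrite le_eqVlt; apply/orP; left; apply/eqP; ring.
Qed.

Lemma sum_powRN_le n a : 0 < a ->
  \sum_(i < n) (i.+1%:R : R) `^ (- (1 + a)) <= 1 + a^-1.
Proof.
move=> a0; case: n => [|n].
  by rewrite big_ord0 addr_ge0 // invr_ge0 ltW.
suff : \sum_(i < n.+1) (i.+1%:R : R) `^ (- (1 + a)) <=
    1 + a^-1 - a^-1 * n.+1%:R `^ (- a).
  move/le_trans; apply; rewrite gerBl.
  by rewrite mulr_ge0 ?powR_ge0 // invr_ge0 ltW.
elim: n => [|n IH].
  by rewrite big_ord1 !powR1 mulr1 addrK.
rewrite big_ord_recr /=; apply: le_trans (lerD IH (lexx _)) _.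
set x : R := n.+1%:R; set y : R := n.+2%:R.
have x0 : 0 < x by rewrite ltr0n.
have y0 : 0 < y by rewrite ltr0n.
have yE : y = x + 1 by rewrite /x /y natr1.
have := powRN_succ_le x0 a0; rewrite -yE mulrBr; lra.
Qed.

Lemma geometric_bound (u : nat -> R) rho k0 :
  0 < rho -> (forall k, 0 <= u k) ->
  (forall k, (k0 <= k)%N -> u k.+1 <= rho * u k) ->
  exists2 C, 0 < C & forall k, u k <= C * rho ^+ k.
Proof.
(* The sum dominates each of the finitely many ratios before the recursion starts; the added 1 makes
   [C] positive. *)
move=> r0 u0 H; pose C := 1 + \sum_(i < k0.+1) u i / rho ^+ i; exists C.
  by rewrite ltr_pwDl // sumr_ge0 // => i _; rewrite divr_ge0 ?exprn_ge0 // ltW.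
have base k : (k <= k0)%N -> u k <= C * rho ^+ k.
  move=> kk0; rewrite -ler_pdivrMr ?exprn_gt0 // /C.
  rewrite (bigD1 (Ordinal (kk0 : (k < k0.+1)%N))) //= addrCA lerDl.
  by rewrite addr_ge0 // sumr_ge0 // => i _; rewrite divr_ge0 ?exprn_ge0 // ltW.
elim=> [|k IH]; first exact: base.
have [kk0|kk0] := leqP k.+1 k0; first exact: base.
apply: le_trans (H k kk0) _.
by rewrite exprS mulrCA ler_wpM2l // ltW.
Qed.

Lemma dyadic n : (0 < n)%N -> exists k, (2 ^ k <= n < 2 ^ k.+1)%N.
Proof. by move=> n0; exists (trunc_log 2 n); exact: trunc_log_bounds. Qed.

(** Potter-type bounds. Ratio 2 alone suffices: it gives geometric bounds for [f] and for its
    inverse along powers of two, and monotonicity fills the gaps at the price of a constant. *)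
Lemma regular_variation_bounds (f : R -> R) (gamma e : R) :
  (forall x, 0 < x -> 0 < f x <= 1) ->
  (forall x y, 0 < x -> x <= y -> f y <= f x) ->
  regularly_varying f (- gamma) -> 0 < e ->
  exists2 C, 0 < C & forall n, (0 < n)%N ->
    f n%:R <= C * n%:R `^ (- gamma + e) /\ n%:R `^ (- gamma - e) <= C * f n%:R.
Proof.
move=> f01 fdec [_ /(_ 2 (ltr0n _ 2))] rv e0.
have f0 x : 0 < x -> 0 < f x by move=> /f01/andP[].
have two1 : 1 < 2 :> R by rewrite ltr1n.
have up : 2 `^ (- gamma) < 2 `^ (- gamma + e) :> R.
  by rewrite !powRE // ltr_expR ltr_pM2r ?ln_gt0 // ltrDl.
have lo : 2 `^ (- gamma - e) < 2 `^ (- gamma) :> R.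
  by rewrite !powRE // ltr_expR ltr_pM2r ?ln_gt0 // gtrBl.
have [M [_ HM]] : \forall t \near +oo, 2 `^ (- gamma - e) < f (2 * t) / f t < 2 `^ (- gamma + e).
  near=> t; apply/andP; split; near: t.
    exact: (cvgr_gt _ rv).
  exact: (cvgr_lt _ rv).
have p2 k : 0 < (2 ^ k)%N%:R :> R by rewrite ltr0n expn_gt0.
have [k0 Hk0] : exists k0, forall k, (k0 <= k)%N -> M < (2 ^ k)%N%:R.
  have [m Hm] : exists m : nat, M < m%:R.
    exists (Num.Def.truncn (Num.max M 0)).+1.
    apply: (@le_lt_trans _ _ (Num.max M 0)); first by rewrite le_max lexx.
    by apply: truncnS_gt.
  exists m => k mk; apply: lt_trans Hm _; rewrite ltr_nat.
  by apply: leq_ltn_trans mk _; exact: ltn_expl.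
have next k : ((2 ^ k.+1)%N%:R : R) = 2 * (2 ^ k)%N%:R.
  by rewrite expnS natrM.
have [C1 C10 H1] : exists2 C, 0 < C &
    forall k, f (2 ^ k)%N%:R <= C * (2 `^ (- gamma + e)) ^+ k.
  apply: (@geometric_bound _ _ k0) => [|k|k /Hk0/HM/andP[_ H]].
  - exact: powR_gt0.
  - by rewrite ltW ?f0.
  - by rewrite next -ler_pdivrMr ?f0 // ltW.
have [C2 C20 H2] : exists2 C, 0 < C &
    forall k, (f (2 ^ k)%N%:R)^-1 <= C * ((2 `^ (- gamma - e))^-1) ^+ k.
  apply: (@geometric_bound _ _ k0) => [|k|k /Hk0/HM/andP[H _]].
  - by rewrite invr_gt0 powR_gt0.
  - by rewrite invr_ge0 ltW ?f0.
  - rewrite next -invfM lef_pV2 ?posrE ?mulr_gt0 ?powR_gt0 ?f0 ?mulr_gt0 //.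
    by rewrite -ler_pdivlMr ?f0 // ltW.
pose A1 : R := 2 `^ `|- gamma + e|; pose A2 : R := 2 `^ `|- gamma - e|.
have A10 : 0 < A1 by exact: powR_gt0.
have A20 : 0 < A2 by exact: powR_gt0.
exists (C1 * A1 + C2 * A2) => [|n n0].
  by rewrite addr_gt0 // mulr_gt0.
have [k /andP[kn nk]] := dyadic n0.
have nR : 0 < n%:R :> R by rewrite ltr0n.
have kn' : (2 ^ k)%N%:R <= n%:R :> R by rewrite ler_nat.
have nk' : n%:R <= (2 ^ k.+1)%N%:R :> R by rewrite ler_nat ltnW.
split.
  apply: le_trans (fdec _ _ (p2 k) kn') _; apply: le_trans (H1 k) _.
  rewrite -powR2n mulrDl -mulrA; apply: (@le_trans _ _ (C1 * (A1 * n%:R `^ (- gamma + e)))).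
    rewrite ler_wpM2l ?(ltW C10) //; apply: powR_le_factor2 => //.
      by rewrite (le_trans kn') // ler_peMl ?ltW.
    by rewrite -next.
  by rewrite lerDl !mulr_ge0 ?powR_ge0 // ltW.
have := H2 k.+1; rewrite exprVn -powR2n => H.
have fn : f (2 ^ k.+1)%N%:R <= f n%:R by apply: fdec.
have B : (2 ^ k.+1)%N%:R `^ (- gamma - e) <= C2 * f (2 ^ k.+1)%N%:R.
  move: H; rewrite ler_pdivlMr ?powR_gt0 // mulrC ler_pdivrMr ?f0 //.
apply: (@le_trans _ _ (A2 * (C2 * f n%:R))).
  apply: (@le_trans _ _ (A2 * (2 ^ k.+1)%N%:R `^ (- gamma - e))).
    apply: powR_le_factor2 => //.
      by rewrite (le_trans nk') // ler_peMl ?ltW.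
    by rewrite next ler_wpM2l.
  rewrite ler_wpM2l ?(ltW A20) //; apply: le_trans B _.
  by rewrite ler_wpM2l // ltW.
rewrite mulrDl mulrA [A2 * C2]mulrC lerDr; apply: mulr_ge0; last by rewrite ltW ?f0.
by rewrite mulr_ge0 // ltW.
Unshelve. all: by end_near. Qed.

End RealAux.

(** * Borel-Cantelli along powers of two *)

Section Rare.
Variables (R : realType) (ph : nat -> R).
Hypothesis ph01 : forall t, 0 <= ph t.+1 <= 1.

Definition expect (t : nat) (h : multigraph -> R) : R := run ph t 0 h one_loop.

Lemma expect_mono t (h h' : multigraph -> R) :
  (forall g, wf t g -> h g <= h' g) -> expect t h <= expect t h'.
Proof. by move=> H; apply: (run_mono ph01 wf_inherited wf_one_loop). Qed.

Lemma expect_cst t c : expect t (fun=> c) = c.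
Proof. exact: (run_cst ph01 _ _ wf_one_loop). Qed.

Lemma expectD t (h h' : multigraph -> R) :
  expect t (fun x => h x + h' x) = expect t h + expect t h'.
Proof. exact: runD. Qed.

Lemma expectZ t c (h : multigraph -> R) :
  expect t (fun x => c * h x) = c * expect t h.
Proof. exact: runZ. Qed.

Lemma expectS t (h : multigraph -> R) : expect t.+1 h = expect t (step ph t h).
Proof. by rewrite /expect runSr. Qed.

Lemma expect_add j k (h : multigraph -> R) :
  expect (j + k) h = expect j (run ph k j h).
Proof. by rewrite /expect run_add. Qed.

Lemma expect_ge0 t h : (forall g, wf t g -> 0 <= h g) -> 0 <= expect t h.
Proof. by move=> H; rewrite -(expect_cst t 0); apply: expect_mono. Qed.

Lemma expect_markov t a h : 0 < a -> (forall g, wf t g -> 0 <= h g) ->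
  expect t (fun x => (a <= h x)%R%:R) <= expect t h / a.
Proof. by move=> a0 h0; apply: (run_markov ph01 wf_one_loop). Qed.

(** At time [2 ^ k] a polynomially small probability is geometric in [k], hence summable. An
    unspecified exponent makes the notion stable under finite unions and lets it absorb
    constants. *)
Definition rare (B : nat -> pred multigraph) : Prop :=
  exists2 delta, 0 < delta &
    \forall k \near \oo, expect (2 ^ k)%N (fun g => (B k g)%:R) <=
                         (2 ^ k)%N%:R `^ (- delta).

Lemma rareI C delta (B : nat -> pred multigraph) : 0 < delta ->
  (\forall k \near \oo, expect (2 ^ k)%N (fun g => (B k g)%:R) <=
                         C * (2 ^ k)%N%:R `^ (- delta)) -> rare B.
Proof.
move=> d0 H; exists (delta / 2); first by rewrite divr_gt0.
have dd : - delta < - (delta / 2) by lra.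
have D := powR2n_dominates C dd.
by near=> k; apply: (@le_trans _ _ (C * (2 ^ k)%N%:R `^ (- delta))); near: k.
Unshelve. all: by end_near. Qed.

Lemma rareW (B B' : nat -> pred multigraph) : rare B ->
  (\forall k \near \oo, forall g, wf (2 ^ k) g -> B' k g -> B k g) -> rare B'.
Proof.
move=> [d d0 H] sub; exists d => //.
near=> k; apply: (@le_trans _ _ (expect (2 ^ k) (fun g => (B k g)%:R))); last by near: k.
have sk : forall g, wf (2 ^ k) g -> B' k g -> B k g by near: k.
apply: expect_mono => g w; have := sk g w.
by case: (B' k g) => [->//|_]; rewrite ler0n.
Unshelve. all: by end_near. Qed.

Lemma rareU (B B' : nat -> pred multigraph) : rare B -> rare B' ->
  rare (fun k g => B k g || B' k g).
Proof.
move=> [d d0 H] [d' d'0 H'].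
apply: (@rareI 2 (Num.min d d')); first by rewrite lt_min d0.
near=> k.
apply: (@le_trans _ _ (expect (2 ^ k) (fun g => (B k g)%:R + (B' k g)%:R))).
  apply: expect_mono => g w; case: (B k g); case: (B' k g) => /=; lra.
have x1 : 1 <= (2 ^ k)%N%:R :> R by rewrite ler1n expn_gt0.
rewrite expectD mulr_natl mulr2n; apply: lerD.
  apply: (@le_trans _ _ ((2 ^ k)%N%:R `^ (- d))); first by near: k.
  by apply: ler_powR => //; rewrite lerN2 ge_min lexx.
apply: (@le_trans _ _ ((2 ^ k)%N%:R `^ (- d'))); first by near: k.
by apply: ler_powR => //; rewrite lerN2 ge_min lexx orbT.
Unshelve. all: by end_near. Qed.

Lemma rare_markov (X : nat -> multigraph -> R) C a b : a < b ->
  (forall k g, wf (2 ^ k) g -> 0 <= X k g) ->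
  (\forall k \near \oo, expect (2 ^ k)%N (X k) <= C * (2 ^ k)%N%:R `^ a) ->
  rare (fun k g => (2 ^ k)%N%:R `^ b <= X k g).
Proof.
move=> ab X0 H; apply: (@rareI C (b - a)); first by rewrite subr_gt0.
near=> k; have x0 : 0 < (2 ^ k)%N%:R :> R by rewrite ltr0n expn_gt0.
apply: le_trans (expect_markov (powR_gt0 b x0) (X0 k)) _.
rewrite opprB powRD_pos // powRN mulrA ler_wpM2r ?invr_ge0 ?powR_ge0 //.
by near: k.
Unshelve. all: by end_near. Qed.

End Rare.

Lemma rare_eventually_not (R : realType) (d : measure_display)
    (T : measurableType d) (P : probability T R) (f : R -> R)
    (Z : nat -> T -> bool) (G : nat -> T -> multigraph)
    (B : nat -> pred multigraph) :
  graph_process P f Z G -> (forall t : nat, 0 <= f t.+1%:R <= 1) ->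
  rare (fun n => f n%:R) B ->
  {ae P, forall omega, \forall k \near \oo, ~~ B k (G (2 ^ k)%N omega)}.
Proof.
move=> proc f01 [dl dl0 [k0 _ Hk0]].
(* Emptying the first events makes the geometric bound valid for every [k], so the whole series is
   at most [1 / (1 - rho)]. *)
pose F k : set T := if (k0 <= k)%N then [set omega | B k (G (2 ^ k)%N omega)] else set0.
have mF k : measurable (F k).
  rewrite /F; case: ifP => // _.
  exact: (measurable_process_pred proc (2 ^ k) (fun h => B k h)).
pose rho : R := 2 `^ (- dl).
have r0 : 0 < rho by exact: powR_gt0.
have r1 : rho < 1.
  rewrite /rho powRE // -[ltRHS]expR0 ltr_expR mulNr oppr_lt0 mulr_gt0 // ln_gt0 //.
  by rewrite ltr1n.
have PF k : (P (F k) <= (rho ^+ k)%:E)%E.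
  rewrite /F; case: ifP => k0k; last by rewrite measure0 lee_fin exprn_ge0 // ltW.
  apply: le_trans (prob_le_run proc f01 _ _) _.
  by rewrite lee_fin -powR2n; exact: Hk0.
have sumF : (\sum_(k <oo) P (F k) < +oo)%E.
  apply: (@le_lt_trans _ _ ((1 - rho)^-1)%:E); last by rewrite ltry.
  apply: lime_le; first exact: is_cvg_nneseries.
  apply: nearW => n.
  apply: (@le_trans _ _ (\sum_(0 <= k < n) (rho ^+ k)%:E)%E).
    by apply: lee_sum => k _; exact: PF.
  have q0 : 0 < 1 - rho by rewrite subr_gt0.
  rewrite sumEFin lee_fin big_mkord -(ler_pM2l q0) mulfV ?gt_eqF //.
  by have := subrX1 rho n; have := exprn_ge0 n (ltW r0); lra.
have := lim_sup_set_cvg0 mF sumF; move=> P0.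
exists (lim_sup_set F); split => //.
  apply: bigcap_measurable => [|k _]; first by exists 0%N.
  by apply: bigcup_measurable.
move=> x /= nev n _; apply: contrapT => H; apply: nev.
exists (maxn n k0) => // k /=; rewrite geq_max => /andP[nk k0k].
apply/negP => Bk; apply: H; exists k => //=.
by rewrite /F k0k.
Qed.

(** * Upper bound on the number of adjacencies *)

Lemma ler_eq (R : numDomainType) (x y : R) : x = y -> x <= y.
Proof. by move=> ->. Qed.

(* As one edge is added per unit of time, this is the time of arrival of [u]. *)
Definition birth (g : multigraph) (u : nat) : nat :=
  find (fun e => (e.1 == u) || (e.2 == u)) (edges g).

Lemma has_deg g u : (0 < deg g u)%N ->
  has (fun e => (e.1 == u) || (e.2 == u)) (edges g).
Proof.
rewrite /deg addn_gt0 -!has_count => /orP[] /hasP[e eg E];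
  by apply/hasP; exists e => //; rewrite E ?orbT.
Qed.

Lemma birth_le t g u : wf t g -> (u < nv g)%N -> (birth g u <= t)%N.
Proof.
move=> [Hs _ _ _ Hd] /Hd/has_deg; rewrite has_find Hs; exact.
Qed.

Lemma birth_add_vertex t g u v : wf t g -> (u < nv g)%N ->
  birth (add_vertex g v) u = birth g u.
Proof.
by move=> [_ _ _ _ Hd] /Hd/has_deg h; rewrite /birth /= -cats1 find_cat h.
Qed.

Lemma birth_add_edge t g u v w : wf t g -> (u < nv g)%N ->
  birth (add_edge g v w) u = birth g u.
Proof.
by move=> [_ _ _ _ Hd] /Hd/has_deg h; rewrite /birth /= -cats1 find_cat h.
Qed.

Lemma birth_new t g v : wf t g -> birth (add_vertex g v) (nv g) = t.+1.
Proof.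
move=> w; have [Hs _ _ He _] := w.
rewrite /birth /= -cats1 find_cat /= eqxx addn0 Hs; case: ifP => // /hasP[e /He].
by move=> /andP[a b]; rewrite !ltn_eqF.
Qed.

(** An adjacent pair is witnessed by at least one edge, in one of two orientations: hence the factor
    2. *)
Lemma sum_adj_le (R : numDomainType) t g (x : nat -> R) : wf t g ->
  (forall u, 0 <= x u) ->
  \sum_(u < nv g) \sum_(v < nv g) (adj g u v)%:R * (x u * x v) <=
  2 * \sum_(e <- edges g) x e.1 * x e.2.
Proof.
move=> [_ _ _ He _] x0.
(* The sum over edges, regrouped by ordered pair of endpoints with multiplicity. *)
have sumN (r : seq (nat * nat)) :
    (forall e, e \in r -> (e.1 < nv g)%N && (e.2 < nv g)%N) ->
    \sum_(u < nv g) \sum_(v < nv g) (count_mem (u : nat, v : nat) r)%:R * (x u * x v) =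
    \sum_(e <- r) x e.1 * x e.2.
  elim: r => [|e r IH] Hr.
    by rewrite big_nil big1 // => u _; rewrite big1 // => v _; rewrite mul0r.
  rewrite big_cons -IH; last by move=> e' er; apply: Hr; rewrite inE er orbT.
  have /andP[en1 en2] : (e.1 < nv g)%N && (e.2 < nv g)%N by apply: Hr; rewrite inE eqxx.
  under eq_bigr do (under eq_bigr do rewrite /= natrD mulrDl; rewrite big_split /=).
  rewrite big_split /=; congr (_ + _).
  rewrite (bigD1 (Ordinal en1)) //= (bigD1 (Ordinal en2)) //=.
  rewrite -surjective_pairing eqxx mul1r big1 ?addr0; last first.
    move=> v ve; rewrite (_ : (e == (e.1, v : nat)) = false) ?mul0r //.
    apply: contraNF ve; rewrite [X in X == _]surjective_pairing => /eqP[E2].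
    by apply/eqP/val_inj.
  rewrite big1 ?addr0 // => u ue; rewrite big1 // => v _.
  rewrite (_ : (e == (u : nat, v : nat)) = false) ?mul0r //.
  apply: contraNF ue; rewrite [X in X == _]surjective_pairing => /eqP[E1 _].
  by apply/eqP/val_inj.
rewrite mulr_natl mulr2n -(sumN _ He).
rewrite [X in _ <= _ + X]exchange_big -big_split; apply: ler_sum => u _ /=.
rewrite -big_split; apply: ler_sum => v _ /=.
rewrite [x v * x u]mulrC -mulrDl -natrD ler_wpM2r ?mulr_ge0 //.
case: (boolP (adj g u v)) => [/andP[_ uv]|_]; last exact: ler0n.
rewrite ler1n addn_gt0 -!has_count !has_pred1; exact: uv.
Qed.

Lemma adjacencies_le t g : wf t g -> (adjacencies g <= 2 * t.+1)%N.
Proof.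
move=> w; have [Hs _ _ _ _] := w.
have := @sum_adj_le int t g (fun=> 1) w (fun=> ler01).
rewrite big_const_seq count_predT Hs iter_addr_0 mulr1.
rewrite -(ler_nat int) natrM; apply: le_trans.
rewrite /adjacencies natr_sum; apply: ler_sum => u _.
rewrite natr_sum; apply: ler_sum => v _; by rewrite !mulr1.
Qed.

(** * Moments of sums weighted by powers of arrival times *)

Section Upper.
Variables (R : realType) (ph : nat -> R) (p K : R).
Hypothesis ph01 : forall t, 0 <= ph t.+1 <= 1.
Hypothesis p01 : 0 < p < 1.
(** The vertex created at step [i + 1] has [birth] equal to [i + 1], and [birth_pow] adds one to
    keep its base positive: hence [i + 2]. The bound [K] below on the sum is the only place where
    the decay of [ph] enters this section. *)
Let d i : R := i.+2%:R `^ (- p).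
Hypothesis sumK : forall n, \sum_(i < n) ph i.+1 * d i <= K.

Let q : R := 1 - p.

Definition birth_pow (a : R) (g : multigraph) (u : nat) : R :=
  (birth g u).+1%:R `^ a.

Definition birth_sum (g : multigraph) : R := \sum_(u < nv g) birth_pow (- p) g u.

(** This is the sum of degree times weight over the vertices; divided by [2 * (t + 1)] it is the
    mean weight of a vertex chosen by [pi_deg]. *)
Definition edge_load (g : multigraph) : R :=
  \sum_(e <- edges g) (birth_pow q g e.1 + birth_pow q g e.2).

Definition edge_energy (g : multigraph) : R :=
  \sum_(e <- edges g) birth_pow q g e.1 * birth_pow q g e.2.

Lemma birth_pow_ge0 a g u : 0 <= birth_pow a g u.
Proof. exact: powR_ge0. Qed.

Lemma birth_sum_ge0 g : 0 <= birth_sum g.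
Proof. by apply: sumr_ge0 => u _; exact: birth_pow_ge0. Qed.

Lemma edge_load_ge0 g : 0 <= edge_load g.
Proof. by apply: sumr_ge0 => e _; rewrite addr_ge0 ?birth_pow_ge0. Qed.

Lemma edge_energy_ge0 g : 0 <= edge_energy g.
Proof. by apply: sumr_ge0 => e _; rewrite mulr_ge0 ?birth_pow_ge0. Qed.

(** The weight, of exponent [q], of the vertex created at step [i + 1]; as weights increase with
    arrival time, it also bounds all earlier ones. *)
Let c i : R := i.+2%:R * d i.

Let d_ge0 i : 0 <= d i. Proof. exact: powR_ge0. Qed.

Let d_le1 i : d i <= 1.
Proof.
have /andP[p0 _] := p01.
rewrite /d -[leRHS](powRr0 (i.+2%:R : R)); apply: ler_powR.
  by rewrite ler1n.
by rewrite oppr_le0 ltW.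
Qed.

Let c_ge0 i : 0 <= c i. Proof. by rewrite mulr_ge0. Qed.

Let cE i : c i = i.+2%:R `^ q.
Proof.
have h : 0 < i.+2%:R :> R by rewrite ltr0n.
by rewrite /q powRD_pos // powRr1 ?(ltW h).
Qed.

Lemma birth_pow_le t g u : wf t g -> (u < nv g)%N -> birth_pow q g u <= c t.
Proof.
move=> w ug; have /andP[p0 p1] := p01.
rewrite cE /birth_pow; apply: ge0_ler_powR; rewrite ?nnegrE ?ler0n //.
  by rewrite /q subr_ge0 ltW.
by rewrite ler_nat ltnS leqW // (birth_le w).
Qed.

Lemma birth_pow_add_vertex a t g u v : wf t g -> (u < nv g)%N ->
  birth_pow a (add_vertex g v) u = birth_pow a g u.
Proof. by move=> w ug; rewrite /birth_pow (birth_add_vertex _ w). Qed.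

Lemma birth_pow_add_edge a t g u v v' : wf t g -> (u < nv g)%N ->
  birth_pow a (add_edge g v v') u = birth_pow a g u.
Proof. by move=> w ug; rewrite /birth_pow (birth_add_edge _ _ w). Qed.

Lemma birth_pow_new a t g v : wf t g ->
  birth_pow a (add_vertex g v) (nv g) = t.+2%:R `^ a.
Proof. by move=> w; rewrite /birth_pow (birth_new _ w). Qed.

Lemma birth_sum_add_vertex t g v : wf t g ->
  birth_sum (add_vertex g v) = birth_sum g + d t.
Proof.
move=> w; rewrite /birth_sum /= big_ord_recr /= (birth_pow_new _ _ w).
by congr (_ + _); apply: eq_bigr => u _; rewrite (birth_pow_add_vertex _ _ w).
Qed.

Lemma birth_sum_add_edge t g v v' : wf t g ->
  birth_sum (add_edge g v v') = birth_sum g.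
Proof.
by move=> w; apply: eq_bigr => u _; rewrite (birth_pow_add_edge _ _ _ w).
Qed.

Lemma edge_load_add_vertex t g v : wf t g -> (v < nv g)%N ->
  edge_load (add_vertex g v) = edge_load g + (c t + birth_pow q g v).
Proof.
move=> w vg; have [_ _ _ He _] := w.
rewrite /edge_load /= big_rcons /= (birth_pow_new _ _ w) -cE.
rewrite (birth_pow_add_vertex _ _ w vg); congr (_ + _).
apply: eq_big_seq => e /He/andP[e1 e2].
by rewrite !(birth_pow_add_vertex _ _ w).
Qed.

Lemma edge_load_add_edge t g v v' : wf t g -> (v < nv g)%N -> (v' < nv g)%N ->
  edge_load (add_edge g v v') = edge_load g + (birth_pow q g v + birth_pow q g v').
Proof.
move=> w vg vg'; have [_ _ _ He _] := w.
rewrite /edge_load /= big_rcons /= !(birth_pow_add_edge _ _ _ w) //.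
congr (_ + _); apply: eq_big_seq => e /He/andP[e1 e2].
by rewrite !(birth_pow_add_edge _ _ _ w).
Qed.

Lemma edge_energy_add_vertex t g v : wf t g -> (v < nv g)%N ->
  edge_energy (add_vertex g v) = edge_energy g + c t * birth_pow q g v.
Proof.
move=> w vg; have [_ _ _ He _] := w.
rewrite /edge_energy /= big_rcons /= (birth_pow_new _ _ w) -cE.
rewrite (birth_pow_add_vertex _ _ w vg); congr (_ + _).
apply: eq_big_seq => e /He/andP[e1 e2].
by rewrite !(birth_pow_add_vertex _ _ w).
Qed.

Lemma edge_energy_add_edge t g v v' : wf t g -> (v < nv g)%N -> (v' < nv g)%N ->
  edge_energy (add_edge g v v') = edge_energy g + birth_pow q g v * birth_pow q g v'.
Proof.
move=> w vg vg'; have [_ _ _ He _] := w.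
rewrite /edge_energy /= big_rcons /= !(birth_pow_add_edge _ _ _ w) //.
congr (_ + _); apply: eq_big_seq => e /He/andP[e1 e2].
by rewrite !(birth_pow_add_edge _ _ _ w).
Qed.

Let avg g (x : nat -> R) : R := \sum_(v < nv g) pi_deg R g v * x v.

Let avgD g x y : avg g (fun v => x v + y v) = avg g x + avg g y.
Proof. by rewrite /avg -big_split; apply: eq_bigr => v _; rewrite mulrDr. Qed.

Let avgZ g a x : avg g (fun v => a * x v) = a * avg g x.
Proof. by rewrite /avg mulr_sumr; apply: eq_bigr => v _; rewrite mulrCA. Qed.

Let avg_cst t g a : wf t g -> avg g (fun=> a) = a.
Proof. by move=> w; rewrite /avg -mulr_suml (sum_pi_deg _ w) mul1r. Qed.

Let avg_le g x y : (forall v, (v < nv g)%N -> x v <= y v) -> avg g x <= avg g y.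
Proof. by move=> H; apply: ler_sum => v _; rewrite ler_wpM2l ?pi_deg_ge0 ?H. Qed.

Lemma step_le_avg t h g A B :
  (forall v, (v < nv g)%N -> h (add_vertex g v) <= A v) ->
  (forall v v', (v < nv g)%N -> (v' < nv g)%N -> h (add_edge g v v') <= B v v') ->
  step ph t h g <= ph t.+1 * avg g A +
    (1 - ph t.+1) * avg g (fun v => avg g (B v)).
Proof.
have /andP[f0 f1] := ph01 t => HA HB; apply: lerD.
  rewrite ler_wpM2l //; apply: ler_sum => v _.
  by rewrite ler_wpM2l ?pi_deg_ge0 ?HA.
rewrite ler_wpM2l ?subr_ge0 //; apply: ler_sum => v _; rewrite /avg mulr_sumr.
apply: ler_sum => v' _; rewrite -mulrA.
by rewrite !ler_wpM2l ?pi_deg_ge0 ?HB.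
Qed.

Let W t g : R := edge_load g / (2 * t.+1%:R).

Let avg_birth_pow t g : wf t g -> avg g (birth_pow q g) = W t g.
Proof.
by move=> w; rewrite /avg (sum_pi_deg_edges _ w) -muln2 natrM [_ * 2]mulrC.
Qed.

Let avg_sqr_le t g : wf t g ->
  avg g (fun v => birth_pow q g v ^+ 2) <= c t * avg g (birth_pow q g).
Proof.
move=> w; rewrite -avgZ; apply: avg_le => v vg.
by rewrite expr2 ler_wpM2r ?birth_pow_ge0 // (birth_pow_le w).
Qed.

Lemma step_birth_sum t g : wf t g ->
  step ph t birth_sum g <= birth_sum g + ph t.+1 * d t.
Proof.
move=> w.
apply: le_trans (@step_le_avg t _ g (fun=> birth_sum g + d t) (fun _ _ => birth_sum g) _ _) _.
- by move=> v _; rewrite (birth_sum_add_vertex _ w).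
- by move=> v v' _ _; rewrite (birth_sum_add_edge _ _ w).
rewrite !(avg_cst _ w); lra.
Qed.

Let W_facts t g :
  [/\ 0 <= W t g, 2 * W t g <= edge_load g &
      t.+2%:R / t.+1%:R * edge_load g = edge_load g + 2 * W t g].
Proof.
have L0 := edge_load_ge0 g; rewrite /W; set L := edge_load g in L0 *.
have n10 : 0 < t.+1%:R :> R by rewrite ltr0n.
have n11 : 1 <= t.+1%:R :> R by rewrite ler1n.
have E : t.+1%:R * (2 * (L / (2 * t.+1%:R))) = L by field; rewrite ?gt_eqF.
have W0 : 0 <= L / (2 * t.+1%:R) by rewrite divr_ge0 // mulr_ge0 // ltW.
split=> //.
  by rewrite -[leRHS]E ler_peMl // mulr_ge0.
by rewrite -[t.+2%:R]natr1; field; rewrite ?gt_eqF.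
Qed.

(** Both endpoints of an edge-step have mean weight [W], and adding [2 W] multiplies the load by
    [(t + 2) / (t + 1)]. After division by [t + 1] only the summable vertex-step terms remain. *)
Lemma step_edge_load t g : wf t g ->
  step ph t edge_load g <=
  t.+2%:R / t.+1%:R * edge_load g + t.+2%:R * (ph t.+1 * d t).
Proof.
move=> w; have /andP[f0 f1] := ph01 t; pose x := birth_pow q g.
apply: le_trans (@step_le_avg t _ g (fun v => (edge_load g + c t) + x v)
    (fun v v' => (edge_load g + x v) + x v') _ _) _.
- by move=> v vg; rewrite (edge_load_add_vertex w vg) addrA.
- by move=> v v' vg vg'; rewrite (edge_load_add_edge w vg vg') addrA.
rewrite avgD (avg_cst _ w).
under eq_fun do rewrite avgD (avg_cst _ w).
rewrite !avgD !(avg_cst _ w) (avg_birth_pow w).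
have [W0 WL ->] := W_facts t g.
have := mulr_ge0 f0 W0; rewrite /c; lra.
Qed.

Let avg_quad t g a b : wf t g ->
  avg g (fun v => a + b * birth_pow q g v + birth_pow q g v ^+ 2) =
  a + b * avg g (birth_pow q g) + avg g (fun v => birth_pow q g v ^+ 2).
Proof. by move=> w; rewrite !avgD avgZ (avg_cst _ w). Qed.

(** The main term is the square of the growth factor of the load. The middle term bounds the mean
    squared weights of the two endpoints: since no weight exceeds [c t], each is at most [c t * W].
    The last one collects what vertex-steps add. *)
Lemma step_sqr_edge_load t g : wf t g ->
  step ph t (fun x => edge_load x ^+ 2) g <=
  (t.+2%:R / t.+1%:R) ^+ 2 * edge_load g ^+ 2 + c t / t.+1%:R * edge_load g
  + ph t.+1 * (3 * c t * edge_load g + c t ^+ 2).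
Proof.
move=> w; have /andP[f0 f1] := ph01 t; pose x := birth_pow q g.
set L := edge_load g.
apply: le_trans (@step_le_avg t _ g
    (fun v => (L + c t) ^+ 2 + 2 * (L + c t) * x v + x v ^+ 2)
    (fun v v' => (L + x v) ^+ 2 + 2 * (L + x v) * x v' + x v' ^+ 2) _ _) _.
- move=> v vg; rewrite (edge_load_add_vertex w vg) -/L -/(x v); apply: ler_eq.
  move: (x v) (c t) => a b; ring.
- move=> v v' vg vg'; rewrite (edge_load_add_edge w vg vg') -/L -/(x v) -/(x v').
  move: (x v) (x v') => a b; apply: ler_eq; ring.
set Wg := W t g; set X := avg g (fun v => x v ^+ 2).
have HW : avg g x = Wg := avg_birth_pow w.
have -> : (fun v => avg g (fun v' => (L + x v) ^+ 2 + 2 * (L + x v) * x v' + x v' ^+ 2)) =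
    (fun v => (L ^+ 2 + 2 * L * Wg + X) + 2 * (L + Wg) * x v + x v ^+ 2).
  by apply/funext => v; rewrite (avg_quad _ _ w) -/x HW -/X; ring.
rewrite !(avg_quad _ _ w) -/x HW -/X.
have [] := W_facts t g; rewrite -/L -/Wg => W0 WL E.
have XcW : X <= c t * Wg by have := avg_sqr_le w; rewrite -/x HW.
have X0 : 0 <= X.
  by apply: sumr_ge0 => v _; rewrite mulr_ge0 ?pi_deg_ge0 // sqr_ge0.
rewrite -exprMn E.
have -> : c t / t.+1%:R * L = 2 * (c t * Wg).
  by rewrite /Wg /W -/L; field.
have L0 : 0 <= L := edge_load_ge0 g.
have h1 : 0 <= ph t.+1 * (c t * (L - 2 * Wg)).
  by rewrite !mulr_ge0 // subr_ge0.
have h2 : 0 <= ph t.+1 * (2 * L * Wg + 2 * Wg ^+ 2 + X).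
  by rewrite mulr_ge0 // !addr_ge0 // ?mulr_ge0 // ?sqr_ge0.
have h3 := sqr_ge0 Wg.
lra.
Qed.

(** The endpoints of an edge-step are independent given the graph, so the product of their weights
    has mean [W^2]: this is what calls for the second moment of the load. *)
Lemma step_edge_energy t g : wf t g ->
  step ph t edge_energy g <= edge_energy g
  + ph t.+1 * c t / (2 * t.+1%:R) * edge_load g
  + (2 * t.+1%:R) ^- 2 * edge_load g ^+ 2.
Proof.
move=> w; have /andP[f0 f1] := ph01 t; pose x := birth_pow q g.
apply: le_trans (@step_le_avg t _ g (fun v => edge_energy g + c t * x v)
    (fun v v' => edge_energy g + x v * x v') _ _) _.
- by move=> v vg; rewrite (edge_energy_add_vertex w vg).
- by move=> v v' vg vg'; rewrite (edge_energy_add_edge w vg vg').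
set Wg := W t g; have HW : avg g x = Wg := avg_birth_pow w.
have -> : (fun v => avg g (fun v' => edge_energy g + x v * x v')) =
    (fun v => edge_energy g + Wg * x v).
  by apply/funext => v; rewrite avgD (avg_cst _ w) avgZ HW mulrC.
rewrite !avgD !avgZ !(avg_cst _ w) HW.
have -> : ph t.+1 * c t / (2 * t.+1%:R) * edge_load g = ph t.+1 * c t * Wg.
  by rewrite /Wg /W; ring.
have -> : (2 * t.+1%:R) ^- 2 * edge_load g ^+ 2 = Wg ^+ 2.
  by rewrite /Wg /W; field.
have := mulr_ge0 f0 (sqr_ge0 Wg); lra.
Qed.

Let k i := ph i.+1 * d i.

Let k_ge0 i : 0 <= k i.
Proof. by have /andP[f0 _] := ph01 i; rewrite mulr_ge0. Qed.

Let E := expect ph.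

Lemma expect_birth_sum t : E t birth_sum <= 1 + K.
Proof.
suff : E t birth_sum <= 1 + \sum_(i < t) k i.
  by move/le_trans; apply; rewrite lerD2l; exact: sumK.
elim: t => [|t IH].
  by rewrite big_ord0 addr0 /E /expect /= /birth_sum big_ord1 /birth_pow powR1.
rewrite /E expectS.
apply: le_trans (expect_mono ph01 (@step_birth_sum t)) _.
rewrite expectD (expect_cst ph01) big_ord_recr /= addrA lerD2r; exact: IH.
Qed.

Lemma expect_edge_load_sum t :
  E t edge_load <= t.+1%:R * (2 + \sum_(i < t) k i).
Proof.
elim: t => [|t IH].
  by rewrite big_ord0 addr0 mul1r /E /expect /= /edge_load big_seq1 /birth_pow powR1.
rewrite /E expectS.
apply: le_trans (expect_mono ph01 (@step_edge_load t)) _.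
rewrite expectD !expectZ (expect_cst ph01) big_ord_recr /= addrA mulrDr lerD2r.
have -> : t.+2%:R * (2 + \sum_(i < t) k i) =
    t.+2%:R / t.+1%:R * (t.+1%:R * (2 + \sum_(i < t) k i)).
  by rewrite mulrA divfK // pnatr_eq0.
by rewrite ler_wpM2l ?divr_ge0.
Qed.

Let K_ge0 : 0 <= K. Proof. by apply: le_trans (sumK 0); rewrite big_ord0. Qed.

Lemma expect_edge_load t : E t edge_load <= t.+1%:R * (2 + K).
Proof.
apply: le_trans (expect_edge_load_sum t) _.
by rewrite ler_wpM2l // lerD2l; exact: sumK.
Qed.

(** Bounds the increments of the second moment of the load divided by [(t + 1)^2]: the first term
    comes from the squared weights of the endpoints, the second from vertex-steps; both are
    summable. *)
Let e2 i := (2 + K) * i.+2%:R `^ (- (1 + p)) + (3 * (2 + K) + 1) * k i.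

Lemma expect_sqr_edge_load_sum t :
  E t (fun x => edge_load x ^+ 2) <= t.+1%:R ^+ 2 * (4 + \sum_(i < t) e2 i).
Proof.
elim: t => [|t IH].
  rewrite big_ord0 addr0 expr1n mul1r /E /expect /= /edge_load big_seq1 /birth_pow powR1.
  lra.
rewrite /E expectS.
apply: le_trans (expect_mono ph01 (@step_sqr_edge_load t)) _.
rewrite !expectD !expectZ expectD expectZ (expect_cst ph01) -/E.
rewrite big_ord_recr /= addrA [leRHS]mulrDr.
have /andP[f0 _] := ph01 t.
have n1 : 0 < t.+1%:R :> R by rewrite ltr0n.
have n2 : 0 < t.+2%:R :> R by rewrite ltr0n.
have EL := expect_edge_load t.
rewrite -addrA; apply: lerD.
  have -> : t.+2%:R ^+ 2 * (4 + \sum_(i < t) e2 i) =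
    (t.+2%:R / t.+1%:R) ^+ 2 * (t.+1%:R ^+ 2 * (4 + \sum_(i < t) e2 i)).
    by field; rewrite ?gt_eqF.
  by rewrite ler_wpM2l // sqr_ge0.
rewrite /e2 [leRHS]mulrDr; apply: lerD.
  apply: (@le_trans _ _ (c t / t.+1%:R * (t.+1%:R * (2 + K)))).
    by rewrite ler_wpM2l // divr_ge0.
  rewrite mulrA divfK ?gt_eqF // opprD powRD_pos // powR_inv1 ?(ltW n2) //.
  rewrite -/(d t) /c; apply: ler_eq; field.
  by rewrite gt_eqF.
set X := E t edge_load in EL *; have dk : d t * k t <= k t by rewrite ler_piMl.
have -> : ph t.+1 * (3 * c t * X + c t ^+ 2) =
    3 * (t.+2%:R * k t) * X + t.+2%:R ^+ 2 * (d t * k t).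
  by rewrite /c /k; ring.
apply: (@le_trans _ _ (3 * (t.+2%:R * k t) * (t.+2%:R * (2 + K)) + t.+2%:R ^+ 2 * k t)).
  apply: lerD; last by rewrite ler_wpM2l ?sqr_ge0.
  rewrite ler_wpM2l ?mulr_ge0 //; apply: le_trans EL _.
  by rewrite ler_wpM2r ?addr_ge0 // ler_nat.
by apply: ler_eq; ring.
Qed.

Let K2 : R := 4 + (2 + K) * (1 + p^-1) + (3 * (2 + K) + 1) * K.

Let sum_e2 t : 4 + \sum_(i < t) e2 i <= K2.
Proof.
have /andP[p0 _] := p01.
rewrite big_split /= -!mulr_sumr /K2 -[leRHS]addrA lerD2l; apply: lerD.
  rewrite ler_wpM2l ?addr_ge0 //.
  have := sum_powRN_le t.+1 p0; rewrite big_ord_recl /= powR1.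
  by apply: le_trans; rewrite lerDr.
by rewrite ler_wpM2l ?addr_ge0 ?mulr_ge0 ?addr_ge0 //; exact: sumK.
Qed.

Lemma expect_sqr_edge_load t :
  E t (fun x => edge_load x ^+ 2) <= t.+1%:R ^+ 2 * K2.
Proof.
apply: le_trans (expect_sqr_edge_load_sum t) _.
by rewrite ler_wpM2l ?sqr_ge0.
Qed.

(** Each edge-step adds at most [K2 / 4] on average, because the load has second moment of order
    [t^2]; vertex-steps add [t + 2] times a summable sequence. The growth is therefore linear. *)
Lemma expect_edge_energy_sum t : E t edge_energy <=
  t.+1%:R * (1 + K2 / 4 + (2 + K) / 2 * \sum_(i < t) k i).
Proof.
have K20 : 0 <= K2.
  by apply: le_trans (sum_e2 0); rewrite big_ord0 addr0.
elim: t => [|t IH].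
  rewrite big_ord0 mulr0 addr0 mul1r /E /expect /= /edge_energy big_seq1 /birth_pow powR1.
  by rewrite mulr1 lerDl divr_ge0.
rewrite /E expectS.
apply: le_trans (expect_mono ph01 (@step_edge_energy t)) _.
rewrite !expectD !expectZ -/E.
rewrite big_ord_recr /=; set S := \sum_(i < t) k i in IH *.
have S0 : 0 <= S by apply: sumr_ge0.
have n1 : 0 < t.+1%:R :> R by rewrite ltr0n.
have EL := expect_edge_load t; have EL2 := expect_sqr_edge_load t.
have /andP[f0 _] := ph01 t.
have h1 : ph t.+1 * c t / (2 * t.+1%:R) * E t edge_load <=
    t.+2%:R * ((2 + K) / 2 * k t).
  have -> : t.+2%:R * ((2 + K) / 2 * k t) =
    ph t.+1 * c t / (2 * t.+1%:R) * (t.+1%:R * (2 + K)).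
    by rewrite /c /k; field; rewrite ?gt_eqF.
  by rewrite ler_wpM2l // divr_ge0 ?mulr_ge0.
have h2 : (2 * t.+1%:R) ^- 2 * E t (fun x => edge_load x ^+ 2) <= K2 / 4.
  have -> : K2 / 4 = (2 * t.+1%:R) ^- 2 * (t.+1%:R ^+ 2 * K2).
    by field; rewrite ?gt_eqF.
  by rewrite ler_wpM2l // invr_ge0 sqr_ge0.
have h3 : t.+2%:R = t.+1%:R + 1 :> R by rewrite natr1.
have h4 : 0 <= (2 + K) / 2 * S by rewrite mulr_ge0 ?divr_ge0 ?addr_ge0.
apply: le_trans (lerD (lerD IH h1) h2) _.
rewrite h3 -subr_ge0 (_ : _ - _ = 1 + (2 + K) / 2 * S) ?addr_ge0 //; ring.
Qed.

Lemma expect_edge_energy t : E t edge_energy <=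
  t.+1%:R * (1 + K2 / 4 + (2 + K) / 2 * K).
Proof.
apply: le_trans (expect_edge_energy_sum t) _.
rewrite ler_wpM2l // lerD2l ler_wpM2l ?divr_ge0 ?addr_ge0 //; exact: sumK.
Qed.

(* Pairs whose birth times have product at most [tau] are counted in the first
   term, the edges between the other pairs in the second. *)
Lemma adjacencies_le_birth g t tau : wf t g -> 0 < tau ->
  (adjacencies g)%:R <=
  tau `^ p * birth_sum g ^+ 2 + 2 * (tau `^ (- q) * edge_energy g).
Proof.
move=> w tau0; have /andP[p0 p1] := p01.
pose x := birth_pow q g; pose y := birth_pow (- p) g.
have x0 u : 0 <= x u by exact: birth_pow_ge0.
have y0 u : 0 <= y u by exact: birth_pow_ge0.
apply: (@le_trans _ _ (\sum_(u < nv g) \sum_(v < nv g)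
    (tau `^ p * (y u * y v) + tau `^ (- q) * ((adj g u v)%:R * (x u * x v))))).
  rewrite /adjacencies natr_sum; apply: ler_sum => u _.
  rewrite natr_sum; apply: ler_sum => v _.
  case: (adj g u v); last by rewrite mul0r mulr0 addr0 !mulr_ge0 ?powR_ge0.
  rewrite mul1r.
  set bu : R := (birth g u).+1%:R; set bv : R := (birth g v).+1%:R.
  have bu0 : 0 < bu by rewrite ltr0n.
  have bv0 : 0 < bv by rewrite ltr0n.
  have [le|gt] := leP (bu * bv) tau.
    apply: (@le_trans _ _ (tau `^ p * (y u * y v))); last first.
      by rewrite lerDl !mulr_ge0 ?powR_ge0.
    rewrite /y /birth_pow -/bu -/bv -powRM ?(ltW bu0) ?(ltW bv0) // powRN.
    rewrite ler_pdivlMr ?powR_gt0 ?mulr_gt0 // mul1r.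
    by apply: ge0_ler_powR; rewrite ?nnegrE ?(ltW p0) ?(ltW tau0) ?mulr_ge0 ?(ltW bu0) ?(ltW bv0).
  apply: (@le_trans _ _ (tau `^ (- q) * (x u * x v))); last first.
    by rewrite lerDr !mulr_ge0 ?powR_ge0.
  rewrite /x /birth_pow -/bu -/bv -powRM ?(ltW bu0) ?(ltW bv0) // powRN mulrC.
  rewrite ler_pdivlMr ?powR_gt0 // mul1r.
  apply: ge0_ler_powR; rewrite ?nnegrE ?(ltW tau0) ?mulr_ge0 ?(ltW bu0) ?(ltW bv0) ?(ltW gt) //.
  by rewrite /q subr_ge0 ltW.
under eq_bigr do rewrite big_split /=.
rewrite big_split /=; apply: lerD.
  apply: ler_eq; rewrite expr2 /birth_sum mulr_suml mulr_sumr.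
  by apply: eq_bigr => u _; rewrite !mulr_sumr.
under eq_bigr do rewrite -mulr_sumr.
rewrite -mulr_sumr mulrCA ler_wpM2l ?powR_ge0 //.
exact: sum_adj_le w x0.
Qed.

(** No arrival time exceeds [tau], so every vertex contributes at least 1 to the right-hand side;
    the number of vertices thus needs no estimate of its own. *)
Lemma nv_le_birth g t tau : wf t g -> t.+1%:R <= tau ->
  (nv g)%:R <= tau `^ p * birth_sum g.
Proof.
move=> w ttau; have /andP[p0 p1] := p01.
have tau0 : 0 < tau by apply: lt_le_trans ttau; rewrite ltr0n.
rewrite mulr_sumr -[X in X%:R]card_ord -sumr_const; apply: ler_sum => u _.
have b0 : 0 < (birth g u).+1%:R :> R by rewrite ltr0n.
rewrite /birth_pow powRN ler_pdivlMr ?powR_gt0 // mul1r.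
apply: ge0_ler_powR; rewrite ?nnegrE ?(ltW p0) ?(ltW tau0) //.
by apply: le_trans ttau; rewrite ler_nat ltnS (birth_le w).
Qed.

End Upper.

(** * Rarity of too many adjacencies or vertices *)

Definition power_bounds (R : realType) (ph : nat -> R) (gamma : R) : Prop :=
  forall e, 0 < e -> exists2 C, 0 < C & forall n, (0 < n)%N ->
    ph n <= C * n%:R `^ (- gamma + e) /\ n%:R `^ (- gamma - e) <= C * ph n.

Lemma rare_many_adjacencies (R : realType) (ph : nat -> R) (gamma r : R) :
  (forall t, 0 <= ph t.+1 <= 1) -> 0 <= gamma < 1 -> power_bounds ph gamma ->
  1 - gamma < r ->
  rare ph (fun k g => ((2 ^ k)%N%:R `^ r < (adjacencies g)%:R) ||
                      ((2 ^ k)%N%:R `^ r < (nv g)%:R)).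
Proof.
move=> ph01 /andP[g0 g1] bounds gr.
have x0 k : 0 < (2 ^ k)%N%:R :> R by rewrite ltr0n expn_gt0.
have x1 k : (2 ^ k)%N.+1%:R <= 2 * (2 ^ k)%N%:R :> R.
  by rewrite -natrM ler_nat mul2n -addnn -[X in (X <= _)%N]addn1 leq_add2l expn_gt0.
(* For [r > 1], in particular whenever [gamma = 0], the deterministic bounds of order [t] suffice.
   Otherwise [gamma > 0], and [p] below is less than 1. *)
have [r1|r1] := leP r 1; last first.
  exists 1 => //; have D := powR2n_dominates 4 r1; near=> k.
  apply: (@le_trans _ _ 0); last exact: powR_ge0.
  rewrite -[leRHS](expect_cst ph01 (2 ^ k) 0); apply: expect_mono => // g w.
  have Dk : 4 * (2 ^ k)%N%:R `^ 1 <= (2 ^ k)%N%:R `^ r :> R by near: k.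
  rewrite powRr1 ?(ltW (x0 k)) // in Dk.
  have [_ _ nvg _ _] := w; have a := adjacencies_le w.
  rewrite -(ler_nat R) in nvg; rewrite -(ler_nat R) natrM in a.
  have := x1 k => xk; rewrite leNgt ltr0n lt0b negb_or -!leNgt.
  apply/andP; split; lra.
pose eta := (r - (1 - gamma)) / 2; pose p := 1 - gamma + eta.
have eta0 : 0 < eta by rewrite divr_gt0 // subr_gt0.
have p01 : 0 < p < 1 by rewrite /p /eta; apply/andP; split; lra.
have /andP[p0 p1] := p01.
have e0 : 0 < eta / 2 by rewrite divr_gt0.
have [C C0 HC] := bounds _ e0.
(* The exponent [- gamma + eta / 2] of [ph] and the exponent [- p] add up to [- (1 + eta / 2)]. *)
pose K := C * (1 + (eta / 2)^-1).
have sumK n : \sum_(i < n) ph i.+1 * i.+2%:R `^ (- p) <= K.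
  apply: (@le_trans _ _ (C * \sum_(i < n) i.+1%:R `^ (- (1 + eta / 2)))); last first.
    by rewrite ler_wpM2l ?(ltW C0) // sum_powRN_le.
  rewrite mulr_sumr; apply: ler_sum => i _.
  have i0 : 0 < i.+1%:R :> R by rewrite ltr0n.
  apply: (@le_trans _ _ (C * i.+1%:R `^ (- gamma + eta / 2) * i.+1%:R `^ (- p))).
    apply: ler_pM; rewrite ?powR_ge0 //; first by have /andP[] := ph01 i.
      by have [] := HC i.+1 isT.
    rewrite !powRN lef_pV2 ?posrE ?powR_gt0 // ?ltr0n //.
    by apply: ge0_ler_powR; rewrite ?nnegrE ?(ltW p0) // ler_nat.
  by rewrite -mulrA -powRD_pos // /p; apply: ler_eq; congr (_ * _ `^ _); lra.
have q4 : 0 < eta / 4 by rewrite divr_gt0.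
have HS := expect_birth_sum ph01 sumK.
have [CM HM] : exists CM, forall t, expect ph t (edge_energy p) <= t.+1%:R * CM.
  by eexists; exact: (expect_edge_energy ph01 p01 sumK).
have CM0 : 0 <= CM.
  have := HM 0%N; rewrite mul1r; apply: le_trans.
  by apply: expect_ge0 => // g _; exact: edge_energy_ge0.
have rareS : rare ph (fun k g => (2 ^ k)%N%:R `^ (eta / 4) <= birth_sum p g).
  apply: (@rare_markov _ _ ph01 (fun=> birth_sum p) (1 + K) 0) => //.
    by move=> k g _; exact: birth_sum_ge0.
  by apply: nearW => k; rewrite powRr0 mulr1.
have rareM : rare ph (fun k g => (2 ^ k)%N%:R `^ (1 + eta / 4) <= edge_energy p g).
  apply: (@rare_markov _ _ ph01 (fun=> edge_energy p) (2 * CM) 1).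
  - by rewrite ltrDl.
  - by move=> k g _; exact: edge_energy_ge0.
  apply: nearW => k; rewrite powRr1 ?(ltW (x0 k)) //; apply: le_trans (HM _) _.
  by rewrite [leRHS]mulrAC ler_wpM2r.
apply: (rareW ph01 (rareU ph01 rareS rareM)).
have pr : p + eta / 2 < r by rewrite /p /eta; lra.
have D := powR2n_dominates (2 `^ p + 2 * 2 `^ (- (1 - p))) pr.
near=> k.
have Dk : (2 `^ p + 2 * 2 `^ (- (1 - p))) * (2 ^ k)%N%:R `^ (p + eta / 2) <=
  (2 ^ k)%N%:R `^ r :> R by near: k.
move=> g w; apply: contraTT; rewrite !negb_or -!ltNge -!leNgt => /andP[Sg Mg].
set x : R := (2 ^ k)%N%:R in Sg Mg Dk *.
have xx : 1 <= x by rewrite ler1n expn_gt0.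
(* The threshold [2 * x] balances the two contributions: both are at most a constant times
   [x^(p + eta / 2)]. *)
have t0 : 0 < 2 * x by rewrite mulr_gt0 ?x0.
have S0 := birth_sum_ge0 p g.
have tp a : (2 * x) `^ a = 2 `^ a * x `^ a by rewrite powRM // ltW ?x0.
have A1 : x `^ p * (x `^ (eta / 4)) ^+ 2 = x `^ (p + eta / 2).
  rewrite -powR_mulrn ?powR_ge0 // -powRrM -powRD_pos ?x0 //; congr (_ `^ _); lra.
have A2 : x `^ (- (1 - p)) * x `^ (1 + eta / 4) <= x `^ (p + eta / 2).
  rewrite -powRD_pos ?x0 //; apply: ler_powR => //; lra.
apply/andP; split; apply: le_trans Dk.
  apply: le_trans (adjacencies_le_birth p01 w t0) _.
  rewrite [leRHS]mulrDl !tp; apply: lerD.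
    rewrite -mulrA ler_wpM2l ?powR_ge0 // -A1 ler_wpM2l ?powR_ge0 //.
    by apply: lerXn2r; rewrite ?nnegrE ?powR_ge0 ?(ltW Sg).
  rewrite -[leRHS]mulrA ler_wpM2l // -[leLHS]mulrA ler_wpM2l ?powR_ge0 //.
  by apply: le_trans A2; rewrite ler_wpM2l ?powR_ge0 // ltW.
apply: le_trans (nv_le_birth p01 w (x1 k)) _.
rewrite -/x tp -mulrA [leRHS]mulrDl.
apply: (@le_trans _ _ (2 `^ p * x `^ (p + eta / 2))); last first.
  by rewrite lerDl !mulr_ge0 ?powR_ge0.
rewrite ler_wpM2l ?powR_ge0 //.
apply: (@le_trans _ _ (x `^ p * x `^ (eta / 4))).
  by rewrite ler_wpM2l ?powR_ge0 // ltW.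
by rewrite -powRD_pos ?x0 //; apply: ler_powR => //; lra.
Unshelve. all: by end_near. Qed.

(** * Many vertices of large degree *)

Section Lower.
Variables (R : realType) (ph : nat -> R).
Hypothesis ph01 : forall t, 0 <= ph t.+1 <= 1.

(** An exponential moment for the lower tail: since [expR (-1) <= 1 / 2], the mean factor is at most
    [1 - ph / 2]. *)
Lemma step_expR_nv t g : wf t g ->
  step ph t (fun x => expR (- (nv x)%:R)) g <=
  expR (- (ph t.+1 / 2)) * expR (- (nv g)%:R).
Proof.
move=> w; have /andP[f0 f1] := ph01 t.
have -> : step ph t (fun x => expR (- (nv x)%:R)) g =
    (ph t.+1 * expR (-1) + (1 - ph t.+1)) * expR (- (nv g)%:R).
  rewrite /step /= -mulr_suml (sum_pi_deg _ w).
  under [X in _ + _ * X]eq_bigr do rewrite -mulr_suml -mulr_sumr (sum_pi_deg _ w) mulr1.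
  rewrite -mulr_suml (sum_pi_deg _ w) -natr1 opprD expRD; ring.
rewrite ler_wpM2r ?expR_ge0 //.
apply: le_trans (expR_ge1Dx _).
have : expR (-1) <= 2^-1 :> R.
  rewrite expRN lef_pV2 ?posrE ?expR_gt0 //; exact: (le_trans _ (expR_ge1Dx _)).
nra.
Qed.

(** Chernoff's bound. Monotonicity of [ph] gives the exponent [m * ph m / 2], and a threshold of
    half that size leaves [expR (- y)], which is then weakened to [1 / y]. *)
Lemma expect_few_vertices m : (0 < m)%N -> 0 < ph m ->
  (forall i, (i < m)%N -> ph m <= ph i.+1) ->
  expect ph m (fun g => ((nv g)%:R < m%:R * ph m / 4)%R%:R) <=
  4 / (m%:R * ph m).
Proof.
move=> m0 pm anti; set y := m%:R * ph m / 4.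
have mR : 0 < m%:R :> R by rewrite ltr0n.
have y0 : 0 < y by rewrite /y divr_gt0 ?mulr_gt0.
have H n : (n <= m)%N ->
    expect ph n (fun x => expR (- (nv x)%:R)) <= expR (- (n%:R * ph m / 2)).
  elim: n => [_|n IH nm].
    by rewrite !mul0r oppr0 expR0 /expect /= expR_le1 oppr_le0.
  rewrite expectS; apply: le_trans (expect_mono ph01 (@step_expR_nv n)) _.
  rewrite expectZ.
  apply: (@le_trans _ _ (expR (- (ph n.+1 / 2)) * expR (- (n%:R * ph m / 2)))).
    by rewrite ler_wpM2l ?expR_ge0 // IH // ltnW.
  rewrite -expRD ler_expR -[n.+1%:R]natr1; have := anti _ nm; lra.
apply: (@le_trans _ _ (expR y * expect ph m (fun x => expR (- (nv x)%:R)))).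
  rewrite -expectZ; apply: expect_mono => // g _.
  case: ltP => [le|_]; last by rewrite mulr_ge0 ?expR_ge0.
  have E1 : true%:R = expR 0 :> R by rewrite expR0.
  by rewrite -expRD E1 ler_expR subr_ge0 ltW.
apply: (@le_trans _ _ (expR (- y))).
  apply: (@le_trans _ _ (expR y * expR (- (m%:R * ph m / 2)))).
    by rewrite ler_wpM2l ?expR_ge0 // H.
  by rewrite -expRD ler_expR /y; lra.
have := expRN_le_powR 1 y0; rewrite !expr1; move/le_trans; apply.
by rewrite /y div1r invf_div.
Qed.

(* The factors are chosen so that a vertex of degree [d], hit with probability
   [pi], multiplies [deg_weight d] by [1 - pi / (2 * d)] on average, and [pi / d]
   does not depend on [d]. *)
Definition deg_weight (d : nat) : R := \prod_(i < d.-1) (1 - (2 * i.+1%:R)^-1).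

Lemma deg_weightS d : (0 < d)%N ->
  deg_weight d.+1 = deg_weight d * (1 - (2 * d%:R)^-1).
Proof. by case: d => // d _; rewrite /deg_weight /= big_ord_recr. Qed.

Let factor_ge0 d : (0 < d)%N -> 2^-1 <= 1 - (2 * d%:R)^-1 :> R.
Proof.
move=> d0; rewrite lerBrDr -lerBrDl (_ : 1 - 2^-1 = 2^-1 :> R); last by field.
rewrite lef_pV2 ?posrE ?mulr_gt0 ?ltr0n //.
by rewrite ler_peMr // ler1n.
Qed.

Lemma deg_weight_gt0 d : 0 < deg_weight d.
Proof.
by apply: prodr_gt0 => i _; apply: lt_le_trans (factor_ge0 (ltn0Sn i)); rewrite invr_gt0.
Qed.

Lemma deg_weight_le1 d : deg_weight d <= 1.
Proof.
apply: prodr_ile1 => i _; apply/andP; split.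
  by apply: le_trans (factor_ge0 (ltn0Sn i)); rewrite invr_ge0.
by rewrite gerBl invr_ge0 mulr_ge0.
Qed.

(** With [n = d - 1], [deg_weight d] is the central binomial coefficient of [2 n] divided by [4^n],
    so it decays like [d^(-1/2)]. *)
Lemma sqr_deg_weight_ge d : (0 < d)%N -> (4 * d%:R)^-1 <= deg_weight d ^+ 2.
Proof.
(* The induction is run with [d - 1] in place of [d], with equality at [d = 2]. *)
have H e : (4 * e.+1%:R)^-1 <= deg_weight e.+2 ^+ 2.
  elim: e => [|e IH].
    rewrite deg_weightS // /deg_weight big_ord0 mul1r mulr1 le_eqVlt.
    by apply/orP; left; apply/eqP; field.
  rewrite deg_weightS // exprMn.
  apply: (@le_trans _ _ ((4 * e.+1%:R)^-1 * (1 - (2 * e.+2%:R)^-1) ^+ 2)); last first.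
    by rewrite ler_wpM2r ?sqr_ge0.
  have e0 : 0 < e.+1%:R :> R by rewrite ltr0n.
  rewrite -[e.+2%:R]natr1; move: (e.+1%:R) e0 => x x0.
  have -> : (4 * x)^-1 * (1 - (2 * (x + 1))^-1) ^+ 2 =
      (4 * (x + 1))^-1 + (16 * x * (x + 1) ^+ 2)^-1.
    by field; rewrite !gt_eqF // addr_gt0.
  by rewrite lerDl invr_ge0 !mulr_ge0 ?sqr_ge0 ?addr_ge0 ?(ltW x0).
case: d => // -[|d] _.
  rewrite /deg_weight big_ord0 expr1n mulr1 invf_le1 ?ler1n //.
apply: le_trans (H d); rewrite lef_pV2 ?posrE ?mulr_gt0 ?ltr0n //.
by rewrite ler_wpM2l // ler_nat.
Qed.

(** Each endpoint chosen by [pi_deg] contributes a mean factor [1 - 1 / (4 (r + 1))], and an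
    edge-step chooses two: hence the rate 1/2. The loss [eps] pays for vertex-steps, which choose
    only one, and for the terms of order [(r + 1)^(-2)]. *)
Lemma step_deg_weight r g v eps : wf r g -> (v < nv g)%N ->
  ph r.+1 + r.+1%:R^-1 <= 4 * eps ->
  step ph r (fun x => deg_weight (deg x v)) g <=
  (1 - (2^-1 - eps) / r.+1%:R) * deg_weight (deg g v).
Proof.
move=> w vg small; have /andP[f0 f1] := ph01 r.
have [_ _ _ _ Hd] := w; have d0 := Hd _ vg.
set d := deg g v in d0 *; set h := deg_weight d.
have h0 : 0 < h := deg_weight_gt0 d.
set pv := pi_deg R g v.
have n0 : 0 < r.+1%:R :> R by rewrite ltr0n.
have dR : 0 < d%:R :> R by rewrite ltr0n.
have pvE : pv = d%:R / (2 * r.+1%:R).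
  by rewrite /pv (pi_degE _ _ w) -muln2 natrM [_ * 2]mulrC.
have h1 : deg_weight d.+1 = h * (1 - (2 * d%:R)^-1) by exact: deg_weightS.
have h2 : deg_weight d.+2 = h * (1 - (2 * d%:R)^-1) * (1 - (2 * (d%:R + 1))^-1).
  by rewrite deg_weightS // h1 natr1.
have -> : step ph r (fun x => deg_weight (deg x v)) g =
    ph r.+1 * ((1 - pv) * h + pv * deg_weight d.+1) +
    (1 - ph r.+1) * ((1 - pv) * ((1 - pv) * h + pv * deg_weight d.+1) +
                     pv * ((1 - pv) * deg_weight d.+1 + pv * deg_weight d.+2)).
  rewrite /step; congr (_ * _ + _ * _).
    have := sum_pi_deg_eq (fun b => deg_weight (d + b)) w vg.
    rewrite addn0 addn1 => <-; apply: eq_bigr => u _.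
    by rewrite deg_add_vertex gtn_eqF.
  pose F b := (1 - pv) * deg_weight (d + b) + pv * deg_weight (d + b).+1.
  have := sum_pi_deg_eq F w vg; rewrite /F addn0 addn1 => <-.
  apply: eq_bigr => u _.
  have := sum_pi_deg_eq (fun b => deg_weight (d + (u == v :> nat) + b)) w vg.
  rewrite addn0 addn1 => <-; rewrite mulr_sumr; apply: eq_bigr => u' _.
  by rewrite deg_add_edge mulrA addnA.
rewrite h1 h2 pvE.
set n : R := r.+1%:R in small n0 *; set x : R := d%:R in dR *.
set f := ph r.+1 in f0 f1 small *.
have -> : f * ((1 - x / (2 * n)) * h + x / (2 * n) * (h * (1 - (2 * x)^-1))) +
    (1 - f) * ((1 - x / (2 * n)) * ((1 - x / (2 * n)) * h + x / (2 * n) * (h * (1 - (2 * x)^-1))) +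
      x / (2 * n) * ((1 - x / (2 * n)) * (h * (1 - (2 * x)^-1)) +
      x / (2 * n) * (h * (1 - (2 * x)^-1) * (1 - (2 * (x + 1))^-1)))) =
    (1 - (2^-1 - f / 4) / n +
      (1 - f) * ((4 * n) ^- 2 + (1 - (2 * x)^-1) * (x / (x + 1)) / (8 * n ^+ 2))) * h.
  by field; rewrite !gt_eqF // addr_gt0.
rewrite ler_wpM2r ?(ltW h0) //.
have z0 : 0 <= 1 - (2 * x)^-1.
  by apply: le_trans (factor_ge0 d0); rewrite invr_ge0.
have z1 : 0 <= x / (x + 1) by rewrite divr_ge0 ?addr_ge0 ?(ltW dR).
have k0 : 0 <= (1 - (2 * x)^-1) * (x / (x + 1)) by exact: mulr_ge0.
have k1 : (1 - (2 * x)^-1) * (x / (x + 1)) <= 1.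
  rewrite -[leRHS]mul1r; apply: ler_pM => //.
    by rewrite gerBl invr_ge0 mulr_ge0 ?(ltW dR).
  by rewrite ler_pdivrMr ?addr_gt0 // mul1r lerDl.
set k := (1 - (2 * x)^-1) * (x / (x + 1)) in k0 k1 *.
have m0 : 0 < n^-1 by rewrite invr_gt0.
have -> : (4 * n) ^- 2 + k / (8 * n ^+ 2) = (n^-1) ^+ 2 * (16^-1 + k / 8).
  by field; rewrite gt_eqF.
have s2 : 0 <= (n^-1) ^+ 2 by exact: sqr_ge0.
have b1 : (1 - f) * (16^-1 + k / 8) <= 4^-1.
  by apply: (@le_trans _ _ (1 * (16^-1 + 8^-1))); [apply: ler_pM; lra|lra].
have b2 : (1 - f) * ((n^-1) ^+ 2 * (16^-1 + k / 8)) <= (n^-1) ^+ 2 / 4.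
  by rewrite mulrCA ler_wpM2l.
have b3 : n^-1 * (f + n^-1) <= n^-1 * (4 * eps) by rewrite ler_wpM2l ?(ltW m0).
move: b2 b3; rewrite mulrDr expr2; move: (n^-1) => m b2 b3; lra.
Qed.

(** The growth of the power of time is absorbed by the mean decrease of [deg_weight]. *)
Lemma powR_step_le (a n : R) : 0 <= a -> 0 < n ->
  (n + 1) `^ a * (1 - a / n) <= n `^ a.
Proof.
move=> a0 n0; have n10 : 0 < n + 1 by rewrite addr_gt0.
have E : n `^ a = (n + 1) `^ a * expR (- (a * (ln (n + 1) - ln n))).
  by rewrite !powRE // -expRD; congr expR; ring.
rewrite E ler_wpM2l ?powR_ge0 //; apply: le_trans (expR_ge1Dx _).
rewrite lerD2l lerN2 ler_wpM2l // -ln_div ?posrE //.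
have -> : (n + 1) / n = 1 + n^-1 by field; rewrite gt_eqF.
apply: le_ln1Dx; apply: (@lt_trans _ _ 0); first by rewrite ltrN10.
by rewrite invr_gt0.
Qed.

Lemma run_deg_weight m k g v eps : eps <= 2^-1 -> wf m g -> (v < nv g)%N ->
  (forall r, (m <= r)%N -> ph r.+1 + r.+1%:R^-1 <= 4 * eps) ->
  run ph k m (fun x => deg_weight (deg x v)) g <=
  (m.+1%:R / (m + k).+1%:R) `^ (2^-1 - eps).
Proof.
move=> e2 w vg small; set a := 2^-1 - eps.
have a0 : 0 <= a by rewrite subr_ge0.
have := @run_supermartingale R ph ph01 (fun r g' => wf r g' /\ (v < nv g')%N)
  (fun r x => r.+1%:R `^ a * deg_weight (deg x v)) k m g (@wf_nv_ge_inherited v.+1).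
rewrite runZ => /(_ _ (conj w vg)) H.
have mk0 : 0 < (m + k).+1%:R :> R by rewrite ltr0n.
rewrite powRM ?invr_ge0 // -(powR_inv1 (ltW mk0)) -powRrM mulN1r powRN.
rewrite ler_pdivlMr ?powR_gt0 // mulrC.
apply: le_trans (H _) _; last by rewrite ler_piMr ?powR_ge0 // deg_weight_le1.
move=> r g' /andP[mr _] [w' v'].
rewrite stepZ.
have n0 : 0 < r.+1%:R :> R by rewrite ltr0n.
apply: (@le_trans _ _ (r.+2%:R `^ a * ((1 - a / r.+1%:R) * deg_weight (deg g' v)))).
  by rewrite ler_wpM2l ?powR_ge0 // step_deg_weight // small.
rewrite mulrA ler_wpM2r ?(ltW (deg_weight_gt0 _)) //.
by rewrite -natr1; exact: powR_step_le.
Qed.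

(** Markov's inequality: a degree below [X] forces [deg_weight] to be at least [1 / (2 sqrt X)]. The
    bound does not involve the degree at time [m], so it serves all vertices present then. *)
Lemma run_small_degree m k g v eps X : eps <= 2^-1 -> wf m g -> (v < nv g)%N ->
  0 <= X ->
  (forall r, (m <= r)%N -> ph r.+1 + r.+1%:R^-1 <= 4 * eps) ->
  run ph k m (fun x => ((deg x v)%:R < X)%R%:R) g <=
  2 * Num.sqrt X * (m.+1%:R / (m + k).+1%:R) `^ (2^-1 - eps).
Proof.
move=> e2 w vg X0 small.
apply: (@le_trans _ _ (2 * Num.sqrt X * run ph k m (fun x => deg_weight (deg x v)) g)).
  rewrite -runZ.
  apply: (run_mono ph01 (@wf_nv_ge_inherited v.+1) (conj w vg)) => g' [[_ _ _ _ Hd] /Hd d0].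
  have h0 := deg_weight_gt0 (deg g' v).
  case: ltP => dX; last by rewrite !mulr_ge0 ?sqrtr_ge0 ?(ltW h0).
  have dR : 0 < (deg g' v)%:R :> R by rewrite ltr0n.
  have : 1 <= (2 * Num.sqrt X * deg_weight (deg g' v)) ^+ 2.
    rewrite !exprMn sqr_sqrtr //.
    apply: (@le_trans _ _ (2 ^+ 2 * X * (4 * (deg g' v)%:R)^-1)).
      by rewrite ler_pdivlMr ?mulr_gt0 // mul1r; lra.
    by rewrite ler_wpM2l ?mulr_ge0 // ?sqr_ge0 // sqr_deg_weight_ge.
  by rewrite expr_ge1 // !mulr_ge0 ?sqrtr_ge0 ?(ltW h0).
by rewrite ler_wpM2l ?mulr_ge0 ?sqrtr_ge0 // run_deg_weight.
Qed.

Definition num_deg_ge (X : R) (g : multigraph) : nat :=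
  #|[set v : 'I_(nv g) | X <= (deg g v)%:R]%SET|.

Lemma num_deg_ge_lb X g n : (n <= nv g)%N ->
  n%:R - \sum_(v < n) ((deg g v)%:R < X)%R%:R <= (num_deg_ge X g)%:R :> R.
Proof.
move=> ng; rewrite lerBlDr.
rewrite /num_deg_ge -sum1_card natr_sum.
apply: (@le_trans _ _ (\sum_(v < n) ((X <= (deg g v)%:R)%R%:R + ((deg g v)%:R < X)%R%:R))).
  rewrite -[X in X%:R <= _]card_ord -sumr_const; apply: ler_sum => v _.
  by case: leP => _; rewrite ?addr0 ?add0r.
rewrite big_split lerD2r.
rewrite (big_ord_widen (nv g) (fun v => (X <= (deg g v)%:R)%R%:R) ng) /=.
rewrite [leLHS]big_mkcond [leRHS]big_mkcond; apply: ler_sum => v _.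
by rewrite inE; case: (v < n)%N; case: (X <= (deg g v)%:R)%R.
Qed.

(** If fewer than half of the [n] old vertices are large, more than [n / 2] of them are small;
    Markov's inequality for the number of small ones costs a factor 2, whatever their dependence. *)
Lemma run_few_large_degrees m k g (eps X : R) : eps <= 2^-1 -> wf m g -> 0 <= X ->
  (forall r, (m <= r)%N -> ph r.+1 + r.+1%:R^-1 <= 4 * eps) ->
  run ph k m (fun x => ((num_deg_ge X x)%:R < (nv g)%:R / 2 :> R)%R%:R) g <=
  4 * Num.sqrt X * (m.+1%:R / (m + k).+1%:R) `^ (2^-1 - eps).
Proof.
move=> e2 w X0 small; set n := nv g.
have [_ n0 _ _ _] := w.
have nR : 0 < n%:R :> R by rewrite ltr0n.
apply: (@le_trans _ _ (2 / n%:R * run ph k m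
    (fun x => \sum_(v <- index_enum 'I_n) ((deg x v)%:R < X)%R%:R) g)).
  rewrite -runZ.
  apply: (run_mono ph01 (@wf_nv_ge_inherited n) (conj w (leqnn n))) => g' [_ ng].
  have := num_deg_ge_lb X ng.
  set S := \sum_(v < n) _ => HS.
  have S0 : 0 <= S by apply: sumr_ge0 => v _; rewrite ler0n.
  case: ltP => H; last by rewrite mulr_ge0 // divr_ge0 // ltW.
  by rewrite mulrAC ler_pdivlMr // mul1r; lra.
rewrite (run_sum ph01 _ _ _ w).
apply: (@le_trans _ _ (2 / n%:R * (n%:R * (2 * Num.sqrt X *
    (m.+1%:R / (m + k).+1%:R) `^ (2^-1 - eps))))).
  rewrite ler_wpM2l ?divr_ge0 ?(ltW nR) //.
  rewrite mulr_natl -[X in _ *+ X]card_ord -sumr_const.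
  by apply: ler_sum => v _; apply: run_small_degree.
by apply: ler_eq; field; rewrite ?gt_eqF.
Qed.

Lemma expect_few_large_degrees m k (eps X y : R) : eps <= 2^-1 -> 0 <= X ->
  (forall r, (m <= r)%N -> ph r.+1 + r.+1%:R^-1 <= 4 * eps) ->
  expect ph (m + k) (fun x => ((num_deg_ge X x)%:R < y / 2)%R%:R) <=
  expect ph m (fun g => ((nv g)%:R < y)%R%:R) +
  4 * Num.sqrt X * (m.+1%:R / (m + k).+1%:R) `^ (2^-1 - eps).
Proof.
move=> e2 X0 small; rewrite expect_add.
set D := (X in _ <= _ + X).
have D0 : 0 <= D by rewrite !mulr_ge0 ?sqrtr_ge0 ?powR_ge0.
rewrite -[X in _ + X](expect_cst ph01 m D) -expectD.
apply: expect_mono => // g w.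
case: (ltP (nv g)%:R y) => ny.
  apply: (@le_trans _ _ 1); last by rewrite lerDl.
  rewrite -[leRHS](run_cst ph01 k 1 w).
  by apply: (run_mono ph01 wf_inherited w) => g' _; case: ltP.
rewrite add0r; apply: le_trans (run_few_large_degrees k e2 w X0 small).
apply: (run_mono ph01 wf_inherited w) => g' _.
case: (ltP _ (y / 2)) => h1; last exact: ler0n.
case: ltP => h2 //; exfalso; lra.
Qed.

End Lower.

(** * Exponents for the number of vertices of large degree *)

Section LowerAsymptotics.
Variables (R : realType) (ph : nat -> R) (gamma : R).
Hypothesis ph01 : forall t, 0 <= ph t.+1 <= 1.
Hypothesis gamma01 : 0 <= gamma < 1.
Hypothesis bounds : power_bounds ph gamma.
Hypothesis ph_anti : forall i j, (0 < i <= j)%N -> ph j <= ph i.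
Hypothesis ph_small : forall e : R, 0 < e -> exists N, forall n, (N <= n)%N -> ph n <= e.

Let X_gt0 k : 0 < (2 ^ k)%N%:R :> R.
Proof. by rewrite ltr0n expn_gt0. Qed.

Let X_ge1 k : 1 <= (2 ^ k)%N%:R :> R.
Proof. by rewrite ler1n expn_gt0. Qed.

Lemma ph_gt0 n : (0 < n)%N -> 0 < ph n.
Proof.
move=> n0; have [C C0 /(_ n n0)[_ H]] := bounds (ltr01 : 0 < 1 :> R).
rewrite -(pmulr_rgt0 _ C0); apply: lt_le_trans H.
by rewrite powR_gt0 // ltr0n.
Qed.

Lemma rare_few_large_degrees alpha eta : 0 < alpha < 1 -> 0 < eta ->
  rare ph (fun k g =>
    (num_deg_ge ((2 ^ k)%N%:R `^ (1 - alpha - eta)) g)%:R <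
    (2 ^ k)%N%:R `^ (alpha * (1 - gamma) - eta) :> R).
Proof.
move=> /andP[al0 al1] eta0; have /andP[g0 g1] := gamma01.
have [e [e0 e1 e2]] : exists e, [/\ 0 < e, e <= eta / 2 & e <= (1 - gamma) / 2].
  exists (Num.min (eta / 2) ((1 - gamma) / 2)).
  by split; rewrite ?lt_min ?ge_min ?lexx ?orbT //; apply/andP; split; rewrite ?mulr_gt0 //; lra.
have [theta thE] : exists theta, theta = 1 - gamma - e by eexists.
have th0 : 0 < theta by rewrite thE; lra.
have [C C0 HC] := bounds e0.
(* The probability of too few large degrees will have exponent [- eta / 2 + (1 - alpha) * eps],
   which is then at most [- eta / 4]. *)
have [eps [eps0 eps1 eps2]] : exists eps, [/\ 0 < eps, eps <= 4^-1 & eps <= eta / 4].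
  exists (Num.min 4^-1 (eta / 4)).
  by split; rewrite ?lt_min ?ge_min ?lexx ?orbT //; apply/andP; split; rewrite ?mulr_gt0 //; lra.
have eps12 : eps <= 2^-1 by lra.
have [N HN] : exists N, forall r, (N <= r)%N -> ph r.+1 + r.+1%:R^-1 <= 4 * eps.
  have e20 : 0 < 2 * eps by rewrite mulr_gt0.
  have [N1 H1] := ph_small e20.
  exists (maxn N1 (Num.truncn (2 * eps)^-1).+1) => r; rewrite geq_max => /andP[r1 r2].
  have := H1 r.+1 (leqW r1).
  have : r.+1%:R^-1 <= 2 * eps.
    rewrite -[leRHS]invrK lef_pV2 ?posrE ?invr_gt0 // ltW //.
    by apply: lt_le_trans (truncnS_gt _) _; rewrite ler_nat leqW.
  move: (ph r.+1) (r.+1%:R^-1) => a b; lra.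
(* The first bound on [delta] comes from the event of too few vertices at time [m], the second from
   that of small degrees. *)
have [delta [d0 d1 d2]] : exists delta, [/\ 0 < delta, delta <= alpha * theta & delta <= eta / 4].
  exists (Num.min (alpha * theta) (eta / 4)).
  by split; rewrite ?lt_min ?ge_min ?lexx ?orbT //; apply/andP; split; rewrite ?mulr_gt0 //; lra.
have D1 : alpha * (1 - gamma) - eta < alpha * theta.
  rewrite thE; have : alpha * e <= e by rewrite ler_piMl // ltW.
  by nra.
have dom1 := powR2n_dominates (8 * (C * 2 `^ theta)) D1.
have dom2 := powR2n_dominates N.+1%:R al0.
apply: (@rareI _ ph (4 * (C * 2 `^ theta) + 4 * 2 `^ (2^-1 - eps)) delta) => //.
near=> k.
have H1 : (8 * (C * 2 `^ theta)) * (2 ^ k)%N%:R `^ (alpha * (1 - gamma) - eta) <=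
  (2 ^ k)%N%:R `^ (alpha * theta) :> R by near: k.
have H2 : N.+1%:R * (2 ^ k)%N%:R `^ 0 <= (2 ^ k)%N%:R `^ alpha :> R by near: k.
have x0 := X_gt0 k; have x1 := X_ge1 k.
set x : R := (2 ^ k)%N%:R in H1 H2 x0 x1 *.
rewrite powRr0 mulr1 in H2.
pose m := Num.truncn (x `^ alpha).
have xa1 : 1 <= x `^ alpha by rewrite -[leLHS](powRr0 x) ler_powR // ltW.
have /andP[mle mgt] : (m%:R <= x `^ alpha) && (x `^ alpha < m.+1%:R).
  by rewrite /m truncn_itv // powR_ge0.
have m0 : (0 < m)%N by rewrite /m truncn_gt0.
have mR : 0 < m%:R :> R by rewrite ltr0n.
have mR1 : 1 <= m%:R :> R by rewrite ler1n.
have mS : m.+1%:R <= 2 * x `^ alpha by rewrite -natr1; lra.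
have mx : x `^ alpha <= 2 * m%:R by move: mgt; rewrite -natr1; lra.
have Nm : (N <= m)%N.
  by rewrite -ltnS -(ltr_nat R); apply: le_lt_trans mgt; apply: le_trans H2; rewrite ler_nat.
have mk : (m <= 2 ^ k)%N.
  rewrite -(ler_nat R); apply: le_trans mle _.
  by rewrite -[leRHS]powRr1 ?(ltW x0) // ler_powR // ltW.
have pm := ph_gt0 m0.
have mpm : x `^ (alpha * theta) <= C * 2 `^ theta * (m%:R * ph m).
  have [_ B] := HC m m0.
  have -> : C * 2 `^ theta * (m%:R * ph m) = 2 `^ theta * (m%:R * (C * ph m)) by ring.
  apply: (@le_trans _ _ (2 `^ theta * (m%:R * m%:R `^ (- gamma - e)))); last first.
    by rewrite ler_wpM2l ?powR_ge0 // ler_wpM2l // ltW.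
  rewrite -[X in X * _ `^ (- gamma - e)]powRr1 ?(ltW mR) // -powRD_pos //.
  have -> : 1 + (- gamma - e) = theta by rewrite thE; ring.
  rewrite -powRM ?(ltW mR) // powRrM.
  by apply: ge0_ler_powR; rewrite ?nnegrE ?powR_ge0 ?mulr_ge0 ?(ltW mR) ?(ltW th0).
have A0 : 0 < C * 2 `^ theta by rewrite mulr_gt0 // powR_gt0.
set X := x `^ (1 - alpha - eta).
have small r : (m <= r)%N -> ph r.+1 + r.+1%:R^-1 <= 4 * eps.
  by move=> mr; apply: HN; apply: leq_trans mr.
have := @expect_few_large_degrees _ _ ph01 m (2 ^ k - m) eps X (m%:R * ph m / 4)
  eps12 (powR_ge0 _ _) small.
rewrite subnKC //; set Y := m%:R * ph m / 4 => HE.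
apply: (@le_trans _ _ (expect ph (2 ^ k)
    (fun g => ((num_deg_ge X g)%:R < Y / 2)%R%:R))).
  apply: expect_mono => // g w.
  have YY : x `^ (alpha * (1 - gamma) - eta) <= Y / 2.
    rewrite /Y -(ler_pM2l A0); move: H1 mpm; move: (C * 2 `^ theta) (m%:R * ph m).
    move=> A B; move: (x `^ (alpha * (1 - gamma) - eta)) (x `^ (alpha * theta)) => a b; lra.
  case: (ltP _ (x `^ _)) => h1; last exact: ler0n.
  by rewrite (lt_le_trans h1 YY).
apply: le_trans HE _; rewrite [leRHS]mulrDl; apply: lerD.
  have anti i : (i < m)%N -> ph m <= ph i.+1 by move=> im; apply: ph_anti.
  apply: le_trans (expect_few_vertices ph01 m0 pm anti) _.
  rewrite -[leRHS]mulrA ler_wpM2l //.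
  rewrite powRN ler_pdivlMr ?powR_gt0 // mulrC ler_pdivrMr ?mulr_gt0 //.
  apply: le_trans mpm; exact: ler_powR.
have a0 : 0 <= 2^-1 - eps by rewrite subr_ge0.
rewrite -!mulrA ler_wpM2l //.
have B : (m.+1%:R / (2 ^ k).+1%:R) `^ (2^-1 - eps) <=
    2 `^ (2^-1 - eps) * x `^ ((alpha - 1) * (2^-1 - eps)).
  rewrite powRrM -powRM ?powR_ge0 //; apply: ge0_ler_powR => //.
  - by rewrite nnegrE divr_ge0.
  - by rewrite nnegrE mulr_ge0 // powR_ge0.
  rewrite ler_pdivrMr ?ltr0n //; apply: le_trans mS _.
  rewrite -mulrA ler_wpM2l // powRB ?(gt_eqF x0) ?implybT // powRr1 ?(ltW x0) //.
  rewrite -mulrA ler_peMr ?powR_ge0 // mulrC ler_pdivlMr // mul1r.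
  by rewrite /x ler_nat.
apply: (@le_trans _ _ (Num.sqrt X * (2 `^ (2^-1 - eps) * x `^ ((alpha - 1) * (2^-1 - eps))))).
  by rewrite ler_wpM2l ?sqrtr_ge0.
rewrite mulrCA ler_wpM2l ?powR_ge0 // -powR12_sqrt ?powR_ge0 // /X -powRrM -powRD_pos //.
apply: ler_powR => //.
have h : (1 - alpha) * eps <= eps by rewrite ler_piMl ?(ltW eps0) // gerBl ltW.
have -> : (1 - alpha - eta) * 2^-1 + (alpha - 1) * (2^-1 - eps) =
  - (eta / 2) + (1 - alpha) * eps by ring.
lra.
Unshelve. all: by end_near. Qed.

End LowerAsymptotics.

(** * Vertices of large degree become adjacent *)

Section Connection.
Variables (R : realType) (ph : nat -> R).
Hypothesis ph01 : forall t, 0 <= ph t.+1 <= 1.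

Let natr_bool_le1 (b : bool) : b%:R <= 1 :> R.
Proof. by case: b. Qed.

Lemma adj_add_vertex g u v w : adj g u v -> adj (add_vertex g w) u v.
Proof.
rewrite /adj /= => /andP[->]; rewrite !mem_rcons !inE.
by move=> /orP[] ->; rewrite !orbT.
Qed.

Lemma adj_add_edge g u v w w' : adj g u v -> adj (add_edge g w w') u v.
Proof.
rewrite /adj /= => /andP[->]; rewrite !mem_rcons !inE.
by move=> /orP[] ->; rewrite !orbT.
Qed.

Lemma adj_new_edge g u v : u != v -> adj (add_edge g u v) u v.
Proof. by move=> uv; rewrite /adj uv /= !mem_rcons !inE eqxx. Qed.

(** Only the edge-step with ordered choice [(u, v)] is credited; the reversed choice and
    vertex-steps are bounded trivially. *)
Lemma step_nonadjacent r g u v : wf r g -> (u < nv g)%N -> (v < nv g)%N ->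
  u != v ->
  step ph r (fun x => (~~ adj x u v)%:R) g <=
  (1 - (1 - ph r.+1) * (pi_deg R g u * pi_deg R g v)) * (~~ adj g u v)%:R.
Proof.
move=> w ug vg uv; have /andP[f0 f1] := ph01 r.
case: (boolP (adj g u v)) => [a|_].
  rewrite mulr0 /step big1 ?mulr0 ?add0r => [|x _]; last first.
    by rewrite adj_add_vertex // mulr0.
  rewrite big1 ?mulr0 // => x _; rewrite big1 // => y _.
  by rewrite adj_add_edge // mulr0.
rewrite mulr1 /step.
set a := pi_deg R g u; set b := pi_deg R g v.
apply: (@le_trans _ _ (ph r.+1 * 1 + (1 - ph r.+1) * (1 - a * b))); last first.
  by apply: ler_eq; ring.
apply: lerD.
  rewrite ler_wpM2l // -[leRHS](sum_pi_deg R w); apply: ler_sum => x _.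
  by rewrite ler_piMr ?pi_deg_ge0 // natr_bool_le1.
rewrite ler_wpM2l ?subr_ge0 //.
have := @sum_pi_deg_eq R r g u (fun i : nat => 1 - i%:R * b) w ug.
rewrite /= ?mulr0n ?mulr1n mul0r subr0 mul1r mulr1 -/a.
have -> : (1 - a) + a * (1 - b) = 1 - a * b by ring.
move=> <-; apply: ler_sum => x _.
have := @sum_pi_deg_eq R r g v (fun i : nat => 1 - (x == u :> nat)%:R * i%:R) w vg.
rewrite /= ?mulr0n ?mulr1n mulr0 subr0 !mulr1 -/b.
have -> : (1 - b) + b * (1 - (x == u :> nat)%:R) = 1 - (x == u :> nat)%:R * b by ring.
move=> <-; rewrite mulr_sumr; apply: ler_sum => y _.
rewrite -mulrA ler_wpM2l ?pi_deg_ge0 // ler_wpM2l ?pi_deg_ge0 //.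
case: (boolP (x == u :> nat)) => [/eqP xu|_]; last by rewrite mul0r subr0 natr_bool_le1.
case: (boolP (y == v :> nat)) => [/eqP yv|_]; last by rewrite mulr0 subr0 natr_bool_le1.
by rewrite xu yv adj_new_edge // mulr1 subrr.
Qed.

(** Degrees never decrease, so the product of degrees at time [t] bounds the chance of a connection
    at every later step. The power [t + k - r] in the supermartingale counts the steps still to
    come. *)
Lemma run_nonadjacent t k g u v (D kappa : R) : wf t g -> (u < nv g)%N ->
  (v < nv g)%N -> u != v -> 0 <= D -> kappa <= 1 ->
  D <= (deg g u * deg g v)%:R ->
  (forall r, (t <= r < t + k)%N ->
    kappa <= (1 - ph r.+1) * (D / (2 * r.+1%:R) ^+ 2)) ->
  run ph k t (fun x => (~~ adj x u v)%:R) g <= (1 - kappa) ^+ k.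
Proof.
move=> w ug vg uv D0 k1 Dg Hk.
have c0 : 0 <= 1 - kappa by rewrite subr_ge0.
pose I r g' := [/\ wf r g', (u < nv g')%N, (v < nv g')%N &
  D <= (deg g' u * deg g' v)%:R].
have HI : inherited I.
  move=> r g' [w' u' v' D']; have [wv we] := wf_inherited w'; split.
    move=> x xg; split; [exact: wv|exact: ltnW|exact: ltnW|].
    apply: le_trans D' _; rewrite ler_nat !deg_add_vertex.
    by apply: leq_mul; exact: leq_addr.
  move=> x y xg yg; split; [exact: we|by []|by []|].
  apply: le_trans D' _; rewrite ler_nat !deg_add_edge.
  by apply: leq_mul; exact: leq_addr.
have := @run_supermartingale R ph ph01 I
  (fun r x => (1 - kappa) ^+ (t + k - r) * (~~ adj x u v)%:R) k t g HI.
rewrite runZ subnn expr0 mul1r addKn => H.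
apply: le_trans (H _ _) _; last 2 first.
- by split.
- by rewrite ler_piMr ?exprn_ge0 // natr_bool_le1.
move=> r g' /andP[tr rk] [w' u' v' D'].
rewrite stepZ -[(t + k - r)%N]prednK ?subn_gt0 // -subnS exprSr -mulrA.
rewrite ler_wpM2l ?exprn_ge0 //.
apply: le_trans (step_nonadjacent w' u' v' uv) _.
rewrite ler_wpM2r ?ler0n // lerD2l lerN2.
apply: le_trans (Hk r _) _; first by rewrite tr.
have /andP[f0 f1] := ph01 r.
rewrite ler_wpM2l ?subr_ge0 // !(pi_degE _ _ w').
have -> : (deg g' u)%:R / r.+1.*2%:R * ((deg g' v)%:R / r.+1.*2%:R) =
    (deg g' u * deg g' v)%:R / (2 * r.+1%:R) ^+ 2 :> R.
  by rewrite -muln2 !natrM; field.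
by rewrite ler_wpM2r // invr_ge0 sqr_ge0.
Qed.

(** The comparison of [nv] allows vertices of [g] to be embedded as vertices of [g']. *)
Definition linked (D : R) (g g' : multigraph) : bool :=
  (nv g <= nv g')%N && [forall u : 'I_(nv g), forall v : 'I_(nv g),
    ((u != v) && (D <= (deg g u * deg g v)%:R)) ==> adj g' u v].

Lemma run_not_linked t k g (D kappa : R) : wf t g -> 0 <= D -> kappa <= 1 ->
  (forall r, (t <= r < t + k)%N ->
    kappa <= (1 - ph r.+1) * (D / (2 * r.+1%:R) ^+ 2)) ->
  run ph k t (fun x => (~~ linked D g x)%:R) g <=
  t.+1%:R ^+ 2 * (1 - kappa) ^+ k.
Proof.
move=> w D0 k1 Hk; have [_ _ nt _ _] := w.
have c0 : 0 <= 1 - kappa by rewrite subr_ge0.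
pose Q (p : 'I_(nv g) * 'I_(nv g)) :=
  (p.1 != p.2) && (D <= (deg g p.1 * deg g p.2)%:R).
apply: (@le_trans _ _ (run ph k t (fun x =>
    \sum_(p <- [seq p <- index_enum ('I_(nv g) * 'I_(nv g))%type | Q p])
       (~~ adj x p.1 p.2)%:R) g)).
  apply: (run_mono ph01 (@wf_nv_ge_inherited (nv g)) (conj w (leqnn _))) => g' [_ ng].
  have S0 (r : seq ('I_(nv g) * 'I_(nv g))) :
      0 <= \sum_(p <- r) (~~ adj g' p.1 p.2)%:R :> R.
    by apply: sumr_ge0 => p _; rewrite ler0n.
  rewrite /linked ng /=; case: (boolP [forall u, _]) => // /forallPn[u /forallPn[v]].
  rewrite negb_imply => /andP[Quv nadj].
  rewrite big_filter (bigD1 (u, v)) //= nadj lerDl.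
  by apply: sumr_ge0 => p _; rewrite ler0n.
rewrite (run_sum ph01 _ _ _ w).
apply: (@le_trans _ _ (\sum_(p <- index_enum ('I_(nv g) * 'I_(nv g))%type)
   (1 - kappa) ^+ k)).
  rewrite big_filter [leLHS]big_mkcond; apply: ler_sum => -[u v] _.
  case: ifP => [/andP[/= uv Duv]|_]; last exact: exprn_ge0.
  exact: (run_nonadjacent w (ltn_ord u) (ltn_ord v) uv D0 k1 Duv Hk).
rewrite sumr_const card_prod card_ord -[leLHS]mulr_natl ler_wpM2r ?exprn_ge0 //.
by rewrite natrM expr2; apply: ler_pM; rewrite ?ler0n // ler_nat.
Qed.

Lemma linked_triangles (D X : R) g g' : linked D g g' -> 0 <= X -> D <= X ^+ 2 ->
  ('C(num_deg_ge X g, 3) <= triangles g')%N.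
Proof.
move=> /andP[n /forallP L] X0 DX; pose i := widen_ord n.
have ii : injective i by move=> x y /(congr1 val) /= E; exact/val_inj.
rewrite /num_deg_ge -(card_imset _ ii); apply: triangles_ge.
move=> _ _ /imsetP[u uX ->] /imsetP[v vX ->] uv.
have /forallP/(_ v)/implyP := L u; apply; apply/andP; split.
  by apply: contraNneq uv => ->.
apply: le_trans DX _; rewrite natrM expr2.
by move: uX vX; rewrite !inE => uX vX; exact: ler_pM.
Qed.

(** One vertex of degree at least [X] is adjacent to all those of degree at least [Y], except
    possibly itself: hence the predecessor. *)
Lemma linked_cherries (D X Y : R) g g' : linked D g g' -> 0 <= X -> 0 <= Y ->
  D <= X * Y -> (0 < num_deg_ge X g)%N ->
  ('C((num_deg_ge Y g).-1, 2) <= cherries g')%N.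
Proof.
move=> /andP[n /forallP L] X0 Y0 DXY; pose i := widen_ord n.
have ii : injective i by move=> x y /(congr1 val) /= E; exact/val_inj.
move=> /card_gt0P[c]; rewrite inE => cX.
pose A := [set v : 'I_(nv g) | Y <= (deg g v)%:R]%SET.
apply: (@leq_trans 'C(#|i @: (A :\ c)|, 2)); last first.
  apply: (@cherries_ge g' (i c)) => u' /imsetP[v vA ->].
  move: vA; rewrite !inE => /andP[vc vY].
  have /forallP/(_ v)/implyP := L c; apply; apply/andP; split.
    by rewrite eq_sym.
  by apply: le_trans DXY _; rewrite natrM; exact: ler_pM.
rewrite card_imset //; apply: leq_bin2l.
rewrite /num_deg_ge -/A (cardsD1 c A); case: (c \in A) => //=.
by rewrite ?add0n leq_pred.
Qed.

End Connection.

(** * Lower bounds for triangles and cherries *)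

Lemma bin3_ge (R : realFieldType) n : (3 <= n)%N ->
  n%:R ^+ 3 / 27 <= ('C(n, 3))%:R :> R.
Proof.
move=> n3; have E : ('C(n, 3) * 6 = n * n.-1 * n.-2)%N.
  by have := bin_ffact n 3; rewrite !ffactnS ffactn0 muln1 mulnA.
have := congr1 (fun m => m%:R : R) E; rewrite !natrM.
case: n n3 E => // -[//|n] n3 _ /=; rewrite -[n.+2%:R]natr1 -[n.+1%:R]natr1.
have : 1 <= n%:R :> R by rewrite ler1n.
move: (n%:R) => x x1 E; rewrite ler_pdivrMr //.
have -> : ('C(n.+2, 3))%:R = (x + 1 + 1) * (x + 1) * x / 6 :> R by rewrite -E; field.
nra.
Qed.

Lemma bin2_pred_ge (R : realFieldType) n : (3 <= n)%N ->
  n%:R ^+ 2 / 9 <= ('C(n.-1, 2))%:R :> R.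
Proof.
move=> n3; have E : ('C(n.-1, 2) * 2 = n.-1 * n.-2)%N.
  by have := bin_ffact n.-1 2; rewrite !ffactnS ffactn0 muln1.
have := congr1 (fun m => m%:R : R) E; rewrite !natrM.
case: n n3 E => // -[//|n] n3 _ /=; rewrite -[n.+2%:R]natr1 -[n.+1%:R]natr1.
have : 1 <= n%:R :> R by rewrite ler1n.
move: (n%:R) => x x1 E; rewrite ler_pdivrMr //.
have -> : ('C(n.+1, 2))%:R = (x + 1) * x / 2 :> R by rewrite -E; field.
nra.
Qed.

(** Up to time [2 t] a given pair connects with probability at least [t^(e - 1) / 32] per step: 16
    from the square of [2 (r + 1) <= 4 t], and 2 from [ph <= 1 / 2]. Failure throughout is at most
    [expR (- t^e / 32)], hence of order [t^(-3)] as [e * N >= 3], and the union bound over pairs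
    costs [t^2]. *)
Lemma run_not_linked_double (R : realType) (ph : nat -> R) (e : R) (N t : nat) g :
  (forall t, 0 <= ph t.+1 <= 1) -> (0 < t)%N -> 0 < e <= 1 -> 3 <= e * N%:R ->
  (forall r, (t <= r)%N -> ph r.+1 <= 2^-1) -> wf t g ->
  run ph t t (fun x => (~~ linked (t%:R `^ (1 + e)) g x)%:R) g <=
  4 * (32 * N%:R) ^+ N * t%:R `^ (- 1).
Proof.
move=> ph01 t0 /andP[e0 e1] eN phr w; set x : R := t%:R.
have x0 : 0 < x by rewrite ltr0n.
have x1 : 1 <= x by rewrite ler1n.
have [kappa kapE] : exists kappa, kappa = x `^ (e - 1) / 32 by eexists.
have kap1 : kappa <= 1.
  rewrite kapE ler_pdivrMr // mul1r; apply: (@le_trans _ _ (x `^ 0)).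
    by apply: ler_powR => //; rewrite subr_le0.
  by rewrite powRr0 ler1n.
have kap0 : 0 <= kappa by rewrite kapE divr_ge0 // powR_ge0.
have D0 : 0 <= x `^ (1 + e) by exact: powR_ge0.
have Hk r : (t <= r < t + t)%N ->
    kappa <= (1 - ph r.+1) * (x `^ (1 + e) / (2 * r.+1%:R) ^+ 2).
  move=> /andP[r1 r2]; have pr := phr r r1.
  have r0 : 0 < r.+1%:R :> R by rewrite ltr0n.
  have rx : 2 * r.+1%:R <= 4 * x.
    by rewrite /x -!natrM ler_nat; lia.
  rewrite mulrA ler_pdivlMr ?exprn_gt0 ?mulr_gt0 //.
  apply: (@le_trans _ _ (kappa * (4 * x) ^+ 2)).
    rewrite ler_wpM2l //; apply: lerXn2r => //.
    - by rewrite nnegrE mulr_ge0 // ltW.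
    - by rewrite nnegrE mulr_ge0 // ltW.
  have -> : kappa * (4 * x) ^+ 2 = 2^-1 * (x `^ (e - 1) * x ^+ 2).
    by rewrite kapE; field.
  rewrite -powR_mulrn ?(ltW x0) // -powRD_pos // (_ : e - 1 + 2 = 1 + e); last by ring.
  by rewrite ler_wpM2r //; lra.
apply: le_trans (run_not_linked ph01 w D0 kap1 Hk) _.
have xS : t.+1%:R <= 2 * x by rewrite /x -natrM ler_nat; lia.
have y0 : 0 < x `^ e / 32 by rewrite divr_gt0 // powR_gt0.
have kx : kappa * x = x `^ e / 32.
  rewrite kapE mulrAC -[X in _ * X / _](powRr1 (ltW x0)) -powRD_pos //.
  by rewrite subrK.
have eK : (1 - kappa) ^+ t <= (32 * N%:R) ^+ N / x ^+ 3.
  apply: (@le_trans _ _ (expR (- (x `^ e / 32)))).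
    rewrite -kx -mulNr /x expRM_natr; apply: lerXn2r.
    - by rewrite nnegrE subr_ge0.
    - by rewrite nnegrE expR_ge0.
    exact: expR_ge1Dx.
  apply: le_trans (expRN_le_powR N y0) _.
  rewrite -expr_div_n invf_div mulrCA mulrA exprMn ler_wpM2l ?exprn_ge0 //.
  rewrite exprVn lef_pV2 ?posrE ?exprn_gt0 ?powR_gt0 //.
  rewrite -!powR_mulrn ?powR_ge0 ?(ltW x0) // -powRrM.
  by apply: ler_powR.
rewrite powRN powRr1 ?(ltW x0) //.
apply: (@le_trans _ _ ((2 * x) ^+ 2 * ((32 * N%:R) ^+ N / x ^+ 3))).
  apply: ler_pM => //.
    by rewrite exprn_ge0 // subr_ge0.
  by apply: lerXn2r => //; rewrite nnegrE // mulr_ge0 // ltW.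
by apply: ler_eq; field; rewrite gt_eqF.
Qed.

(** Three families at time [2 ^ k], with arrival exponents [1/2 - e], [e] and [1 - 4 e], have degree
    exponents [1/2 + e/2], [1 - 2 e] and [3 e]. Two members of the first, or one of the second with
    one of the third, have degrees of product exponent [1 + e], so they are adjacent by time
    [2 ^ k.+1]: this gives a clique and a star. *)
Lemma rare_few_triangles_or_cherries (R : realType) (ph : nat -> R) (gamma l : R) :
  (forall t, 0 <= ph t.+1 <= 1) -> 0 <= gamma < 1 -> power_bounds ph gamma ->
  (forall i j, (0 < i <= j)%N -> ph j <= ph i) ->
  (forall e : R, 0 < e -> exists N, forall n, (N <= n)%N -> ph n <= e) ->
  0 < l < 1 - gamma ->
  rare ph (fun k g => ((triangles g)%:R < (2 ^ k)%N%:R `^ (3 / 2 * l)) ||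
                      ((cherries g)%:R < (2 ^ k)%N%:R `^ (2 * l))).
Proof.
move=> ph01 gamma01 bounds anti small /andP[l0 l1].
have /andP[g0 g1] := gamma01.
have [e [e0 e1 e2]] : exists e, [/\ 0 < e, e <= 8^-1 & 8 * e <= 1 - gamma - l].
  exists (Num.min 8^-1 ((1 - gamma - l) / 8)).
  have h : Num.min 8^-1 ((1 - gamma - l) / 8) <= (1 - gamma - l) / 8.
    by rewrite ge_min lexx orbT.
  split; last by lra.
    by rewrite lt_min; apply/andP; split; lra.
  by rewrite ge_min lexx.
have large := rare_few_large_degrees ph01 gamma01 bounds anti small.
pose few a b k g := (num_deg_ge ((2 ^ k)%N%:R `^ a : R) g)%:R < (2 ^ k)%N%:R `^ b :> R.
pose th1 := (2^-1 - e) * (1 - gamma) - e / 2; pose th2 := (1 - 4 * e) * (1 - gamma) - e.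
(* The second threshold has exponent [- e * gamma <= 0]; it only serves to guarantee one centre for
   the star. *)
pose bad k g := [|| few (1 - (2^-1 - e) - e / 2) th1 k g,
    few (1 - e - e) (e * (1 - gamma) - e) k g | few (1 - (1 - 4 * e) - e) th2 k g].
have [dl dl0 Hdl] : rare ph bad.
  apply: (rareU ph01); last apply: (rareU ph01); apply: large;
    by [apply/andP; split; lra|lra].
have th1l : l / 2 < th1 by rewrite /th1; nra.
have th2l : l < th2 by rewrite /th2; nra.
have th10 : 0 < th1 by apply: lt_trans th1l; rewrite divr_gt0.
have th20 : 0 < th2 by exact: lt_trans th2l.
pose N := (Num.truncn (3 / e)).+1.
have eN : 3 <= e * N%:R.
  by rewrite mulrC -ler_pdivrMr // ltW // truncnS_gt.
have e01 : 0 < e <= 1 by rewrite e0 /=; lra.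
have half0 : 0 < 2^-1 :> R by rewrite invr_gt0.
have [M1 HM1] := small _ half0.
pose C : R := 4 * (32 * N%:R) ^+ N.
pose B k g := ((triangles g)%:R < (2 ^ k)%N%:R `^ (3 / 2 * l) :> R) ||
              ((cherries g)%:R < (2 ^ k)%N%:R `^ (2 * l) :> R).
have dA := powR2n_dominates 3 th10; have dB := powR2n_dominates 3 th20.
have lC : 3 / 2 * l < 3 * th1 by lra.
have lD : 2 * l < 2 * th2 by lra.
have dC := powR2n_dominates (27 * 2 `^ (3 / 2 * l)) lC.
have dD := powR2n_dominates (9 * 2 `^ (2 * l)) lD.
have : \forall k \near \oo, expect ph (2 ^ k.+1) (fun g => (B k.+1 g)%:R) <=
    (2 ^ k)%N%:R `^ (- dl) + C * (2 ^ k)%N%:R `^ (- 1).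
  near=> k.
  have hA : 3 * (2 ^ k)%N%:R `^ 0 <= (2 ^ k)%N%:R `^ th1 :> R by near: k.
  have hB : 3 * (2 ^ k)%N%:R `^ 0 <= (2 ^ k)%N%:R `^ th2 :> R by near: k.
  have hC : (27 * 2 `^ (3 / 2 * l)) * (2 ^ k)%N%:R `^ (3 / 2 * l) <=
    (2 ^ k)%N%:R `^ (3 * th1) :> R by near: k.
  have hD : (9 * 2 `^ (2 * l)) * (2 ^ k)%N%:R `^ (2 * l) <=
    (2 ^ k)%N%:R `^ (2 * th2) :> R by near: k.
  have kM : (M1 <= k)%N by near: k; exact: nbhs_infty_ge.
  have Hdlk : expect ph (2 ^ k) (fun g => (bad k g)%:R) <=
    (2 ^ k)%N%:R `^ (- dl) by near: k.
  set x : R := (2 ^ k)%N%:R in hA hB hC hD Hdlk *.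
  rewrite powRr0 mulr1 in hA; rewrite powRr0 mulr1 in hB.
  have x0 : 0 < x by rewrite ltr0n expn_gt0.
  have x1 : 1 <= x by rewrite ler1n expn_gt0.
  have x2E : (2 ^ k.+1)%N%:R = 2 * x :> R by rewrite expnS natrM.
  have pk : (0 < 2 ^ k)%N by rewrite expn_gt0.
  have phr r : (2 ^ k <= r)%N -> ph r.+1 <= 2^-1.
    move=> kr; apply: HM1; apply: leqW; apply: leq_trans kr; apply: leq_trans kM _.
    exact/ltnW/ltn_expl.
  rewrite expnS mul2n -addnn expect_add.
  (* Given the graph at time [2 ^ k], the conditional probability is bounded by 1 if that graph is
     bad, and by the failure to link otherwise. *)
  apply: (@le_trans _ _ (expect ph (2 ^ k) (fun g =>
    (bad k g)%:R + C * x `^ (- 1)))); last first.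
    by rewrite expectD (expect_cst ph01) lerD2r.
  apply: expect_mono => // g w.
  have C0 : 0 <= C * x `^ (- 1).
    by rewrite mulr_ge0 ?powR_ge0 // mulr_ge0 // exprn_ge0 // mulr_ge0.
  case: (boolP (bad k g)) => bad_g.
    apply: (@le_trans _ _ 1); last by rewrite lerDl.
    rewrite -[leRHS](run_cst ph01 (2 ^ k) 1 w).
    by apply: (run_mono ph01 wf_inherited w) => g' _; case: (B k.+1 g').
  rewrite add0r; apply: le_trans (run_not_linked_double ph01 pk e01 eN phr w).
  apply: (run_mono ph01 wf_inherited w) => g' _.
  suff : linked (x `^ (1 + e)) g g' -> ~~ B k.+1 g'.
    by case: (linked _ g g') => [/(_ isT)/negbTE ->//|_]; case: (B k.+1 g').
  move=> L; move: bad_g; rewrite !negb_or -!leNgt.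
  move=> /and3P[nA nB nC].
  rewrite x2E !powRM ?(ltW x0) //; apply/andP; split.
    have n3 : (3 <= num_deg_ge (x `^ (1 - (2^-1 - e) - e / 2)) g)%N.
      by rewrite -(ler_nat R); apply: le_trans hA nA.
    have DX : x `^ (1 + e) <= (x `^ (1 - (2^-1 - e) - e / 2)) ^+ 2.
      rewrite -powR_mulrn ?powR_ge0 // -powRrM; apply: ler_powR => //; lra.
    have := linked_triangles L (powR_ge0 _ _) DX; rewrite -(ler_nat R).
    apply: le_trans; apply: le_trans (bin3_ge R n3).
    rewrite ler_pdivlMr // mulrC mulrA; apply: le_trans hC _.
    rewrite [3 * th1]mulrC powRrM powR_mulrn ?powR_ge0 //.
    by apply: lerXn2r; rewrite ?nnegrE ?powR_ge0.
  have n3 : (3 <= num_deg_ge (x `^ (1 - (1 - 4 * e) - e)) g)%N.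
    by rewrite -(ler_nat R); apply: le_trans hB nC.
  have DX : x `^ (1 + e) <= x `^ (1 - e - e) * x `^ (1 - (1 - 4 * e) - e).
    by rewrite -powRD_pos //; apply: ler_powR => //; lra.
  have n0 : (0 < num_deg_ge (x `^ (1 - e - e)) g)%N.
    by rewrite -(ltr0n R); apply: lt_le_trans nB; exact: powR_gt0.
  have := linked_cherries L (powR_ge0 _ _) (powR_ge0 _ _) DX n0; rewrite -(ler_nat R).
  apply: le_trans; apply: le_trans (bin2_pred_ge R n3).
  rewrite ler_pdivlMr // mulrC mulrA; apply: le_trans hD _.
  rewrite [2 * th2]mulrC powRrM powR_mulrn ?powR_ge0 //.
  by apply: lerXn2r; rewrite ?nnegrE ?powR_ge0.
move=> [M _ HM].
have [dd [dd0 dd1 dd2]] : exists dd, [/\ 0 < dd, dd <= dl & dd <= 1].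
  exists (Num.min dl 1).
  by split; rewrite ?lt_min ?ge_min ?lexx ?orbT // dl0 ltr01.
(* The factor [2^dd] converts a bound in terms of [2 ^ k] into one at the observation time
   [2 ^ k.+1]. *)
apply: (@rareI _ ph ((1 + C) * 2 `^ dd) dd) => //.
exists M.+1 => // -[//|k] /= Mk; apply: le_trans (HM k Mk) _.
set x : R := (2 ^ k)%N%:R.
have x0 : 0 < x by rewrite ltr0n expn_gt0.
have x1 : 1 <= x by rewrite ler1n expn_gt0.
have C0 : 0 <= C by rewrite mulr_ge0 // exprn_ge0 // mulr_ge0.
have -> : (2 ^ k.+1)%N%:R = 2 * x :> R by rewrite expnS natrM.
have two : 2 `^ dd * 2 `^ (- dd) = 1 :> R by rewrite -powRD_pos // subrr powRr0.
have -> : (1 + C) * 2 `^ dd * (2 * x) `^ (- dd) = (1 + C) * x `^ (- dd).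
  by rewrite powRM ?(ltW x0) // mulrA -[_ * _ * 2 `^ (- dd)]mulrA two mulr1.
rewrite mulrDl mul1r; apply: lerD; first by apply: ler_powR => //; rewrite lerN2.
by rewrite ler_wpM2l //; apply: ler_powR => //; rewrite lerN2.
Unshelve. all: by end_near. Qed.

(** * Conclusion *)

Lemma subsimple_path (G : nat -> multigraph) :
  (forall t, one_step (G t) (G t.+1)) ->
  forall m n, (m <= n)%N -> subsimple (G m) (G n).
Proof.
move=> H m n /subnK <-; elim: (n - m)%N => [|j IH]; first exact: subsimple_refl.
by apply: subsimple_trans IH _; exact: one_step_subsimple.
Qed.

Lemma ln_natr_ge (R : realType) (k n : nat) (a : R) :
  (2 ^ k)%N%:R `^ a <= n%:R :> R -> a * ln (2 ^ k)%N%:R <= ln (n%:R : R).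
Proof.
move=> H; have p0 : 0 < (2 ^ k)%N%:R :> R by rewrite ltr0n expn_gt0.
have q0 : 0 < (2 ^ k)%N%:R `^ a :> R by exact: powR_gt0.
by rewrite -ln_powR ler_ln ?posrE // (lt_le_trans q0).
Qed.

Lemma ln_natr_le (R : realType) (k n : nat) (a : R) : (0 < n)%N ->
  n%:R <= (2 ^ k)%N%:R `^ a :> R -> ln (n%:R : R) <= a * ln (2 ^ k)%N%:R.
Proof.
move=> n0 H; have p0 : 0 < (2 ^ k)%N%:R :> R by rewrite ltr0n expn_gt0.
by rewrite -ln_powR ler_ln ?posrE ?powR_gt0 // ltr0n.
Qed.

(** Monotone counts are bounded from below at [2 ^ k] and from above at [2 ^ k.+1]; replacing these
    times by [n] costs [ln 2] on the logarithmic scale. The ratio itself is not monotone, so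
    triangles and cherries are bounded separately. *)
Lemma ln_global_clustering_bounds (R : realType) (G : nat -> multigraph)
    (k n : nat) (l r : R) :
  (forall t, one_step (G t) (G t.+1)) -> (2 ^ k <= n < 2 ^ k.+1)%N ->
  0 < l -> 0 < r ->
  (adjacencies (G (2 ^ k.+1)%N))%:R <= (2 ^ k.+1)%N%:R `^ r :> R ->
  (nv (G (2 ^ k.+1)%N))%:R <= (2 ^ k.+1)%N%:R `^ r :> R ->
  (2 ^ k)%N%:R `^ (3 / 2 * l) <= (triangles (G (2 ^ k)%N))%:R :> R ->
  (2 ^ k)%N%:R `^ (2 * l) <= (cherries (G (2 ^ k)%N))%:R :> R ->
  let L := ln (global_clustering R (G n)) in
  let N : R := ln n%:R in
  ln 3 + 3 / 2 * l * (N - ln 2) - 2 * r * (N + ln 2) <= L /\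
  L <= ln 3 + 3 / 2 * r * (N + ln 2) - 2 * l * (N - ln 2).
Proof.
move=> steps /andP[kn nk] l0 r0 adjU nvU triL cheL L N.
have mono := subsimple_path steps.
have S1 := mono _ _ kn; have S2 := mono _ _ (ltnW nk).
have n0 : (0 < n)%N by apply: leq_trans kn; rewrite expn_gt0.
have nR : 0 < n%:R :> R by rewrite ltr0n.
have pk : 0 < (2 ^ k)%N%:R :> R by rewrite ltr0n expn_gt0.
have pk1 : 0 < (2 ^ k.+1)%N%:R :> R by rewrite ltr0n expn_gt0.
have ln2 : 0 <= ln 2 :> R by rewrite ln_ge0 // ler1n.
have pS : ln (2 ^ k.+1)%N%:R = ln 2 + ln (2 ^ k)%N%:R :> R.
  by rewrite expnS natrM lnM // posrE.
have kN : N - ln 2 <= ln (2 ^ k)%N%:R.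
  by rewrite lerBlDl -pS ler_ln ?posrE // ler_nat ltnW.
have Nk : ln (2 ^ k.+1)%N%:R <= N + ln 2.
  by rewrite pS addrC lerD2r ler_ln ?posrE // ler_nat.
have tri0 : (0 < triangles (G n))%N.
  apply: leq_trans (triangles_mono S1); rewrite -(ltr0n R).
  by apply: lt_le_trans triL; exact: powR_gt0.
have che0 : (0 < cherries (G n))%N.
  apply: leq_trans (cherries_mono S1); rewrite -(ltr0n R).
  by apply: lt_le_trans cheL; exact: powR_gt0.
have tR : 0 < (triangles (G n))%:R :> R by rewrite ltr0n.
have cR : 0 < (cherries (G n))%:R :> R by rewrite ltr0n.
have adj0 : (0 < adjacencies (G n))%N.
  have := leq_trans (_ : 0 < cherries (G n))%N (cherries_le (G n)).
  by move/(_ che0); rewrite muln_gt0 => /andP[].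
have nv0 : (0 < nv (G n))%N.
  have := leq_trans (_ : 0 < cherries (G n))%N (cherries_le (G n)).
  by move/(_ che0); rewrite muln_gt0 => /andP[].
have aR : 0 < (adjacencies (G n))%:R :> R by rewrite ltr0n.
have vR : 0 < (nv (G n))%:R :> R by rewrite ltr0n.
have LE : L = ln 3 + ln (triangles (G n))%:R - ln (cherries (G n))%:R.
  by rewrite /L /global_clustering ln_div ?posrE ?mulr_gt0 // lnM ?posrE.
have tl : 3 / 2 * l * (N - ln 2) <= ln (triangles (G n))%:R.
  apply: (@le_trans _ _ (3 / 2 * l * ln (2 ^ k)%N%:R)).
    by rewrite ler_wpM2l // mulr_ge0 ?divr_ge0 // ltW.
  apply: ln_natr_ge; apply: le_trans triL _.
  by rewrite ler_nat; exact: triangles_mono.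
have cl : 2 * l * (N - ln 2) <= ln (cherries (G n))%:R.
  apply: (@le_trans _ _ (2 * l * ln (2 ^ k)%N%:R)).
    by rewrite ler_wpM2l // mulr_ge0 // ltW.
  apply: ln_natr_ge; apply: le_trans cheL _.
  by rewrite ler_nat; exact: cherries_mono.
have al : ln (adjacencies (G n))%:R <= r * (N + ln 2).
  apply: (@le_trans _ _ (r * ln (2 ^ k.+1)%N%:R)).
    apply: ln_natr_le => //; apply: le_trans adjU.
    by rewrite ler_nat; exact: adjacencies_mono.
  by rewrite ler_wpM2l // ltW.
have vl : ln (nv (G n))%:R <= r * (N + ln 2).
  apply: (@le_trans _ _ (r * ln (2 ^ k.+1)%N%:R)).
    apply: ln_natr_le => //; apply: le_trans nvU.
    by rewrite ler_nat; case: S2.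
  by rewrite ler_wpM2l // ltW.
have tu : ln (triangles (G n))%:R *+ 2 <= ln (adjacencies (G n))%:R *+ 3 :> R.
  rewrite -!lnXn // ler_ln ?posrE ?exprn_gt0 // -!natrX ler_nat.
  exact: triangles_le.
have cu : ln (cherries (G n))%:R <= ln (adjacencies (G n))%:R + ln (nv (G n))%:R :> R.
  rewrite -lnM ?posrE // ler_ln ?posrE ?mulr_gt0 // -natrM ler_nat.
  exact: cherries_le.
have tu' : 2 * ln (triangles (G n))%:R <= 3 * ln (adjacencies (G n))%:R :> R.
  by rewrite !mulr_natl.
rewrite LE -!mulrA; rewrite -!mulrA in tl cl.
move: (l * (N - ln 2)) (r * (N + ln 2)) (ln 3) tl cl al vl tu' cu.
move: (ln (triangles _)%:R) (ln (cherries _)%:R) (ln (adjacencies _)%:R) (ln (nv _)%:R).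
clear; move=> a b c d x y z *; split; lra.
Qed.

Theorem corollary1p4 (R : realType) (d : measure_display)
    (T : measurableType d) (P : probability T R)
    (f : R -> R) (gamma : R)
    (Z : nat -> T -> bool) (G : nat -> T -> multigraph)
    (f_range : forall x, 0 < x -> 0 < f x <= 1)
    (f_decr : forall x y, 0 < x -> x <= y -> f y <= f x)
    (f_cvg0 : f x @[x --> +oo] --> 0)
    (gamma_range : 0 <= gamma < 1)
    (f_rv : regularly_varying f (- gamma))
    (G_process : graph_process P f Z G) :
  {ae P, forall omega,
    ln (global_clustering R (G t omega)) / ln (t%:R : R) @[t --> \oo]
      --> - ((1 - gamma) / 2)}.
Proof.
have /andP[g0 g1] := gamma_range.
have f01 (t : nat) : 0 <= f t.+1%:R <= 1.
  by have /andP[a b] := f_range t.+1%:R (ltr0Sn _ _); rewrite (ltW a).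
pose ph (n : nat) : R := f n%:R.
have bounds : power_bounds ph gamma.
  by move=> e e0; exact: regular_variation_bounds.
have anti i j : (0 < i <= j)%N -> ph j <= ph i.
  by move=> /andP[i0 ij]; apply: f_decr; rewrite ?ltr0n // ler_nat.
have small e : 0 < e -> exists N, forall n, (N <= n)%N -> ph n <= e.
  move=> e0; have [M [_ HM]] : \forall x \near +oo, f x <= e.
    by apply: (cvgr_le _ f_cvg0).
  exists (Num.truncn M).+1 => n Mn; apply: HM.
  by apply: lt_le_trans (truncnS_gt _) _; rewrite ler_nat.
set s := 1 - gamma; have s0 : 0 < s by rewrite subr_gt0.
(* Countably many margins, indexed by [j], so that the exceptional null sets can be united before
   [eps] is chosen. *)
pose many (j k : nat) g :=
  ((2 ^ k)%N%:R `^ (s + j.+1%:R^-1) < (adjacencies g)%:R :> R) ||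
  ((2 ^ k)%N%:R `^ (s + j.+1%:R^-1) < (nv g)%:R :> R).
(* The shift to [j + 2] keeps the exponent strictly between 0 and [s], also for [j = 0]. *)
pose few (j k : nat) g :=
  ((triangles g)%:R < (2 ^ k)%N%:R `^ (3 / 2 * (s * (1 - j.+2%:R^-1))) :> R) ||
  ((cherries g)%:R < (2 ^ k)%N%:R `^ (2 * (s * (1 - j.+2%:R^-1))) :> R).
have H1 (j : nat) : {ae P, forall omega,
    \forall k \near \oo, ~~ many j k (G (2 ^ k)%N omega)}.
  apply: (@rare_eventually_not _ _ _ _ _ _ _ (many j) G_process f01).
  by apply: (rare_many_adjacencies f01 gamma_range bounds); rewrite ltrDl invr_gt0.
have H2 (j : nat) : {ae P, forall omega,
    \forall k \near \oo, ~~ few j k (G (2 ^ k)%N omega)}.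
  apply: (@rare_eventually_not _ _ _ _ _ _ _ (few j) G_process f01).
  apply: (rare_few_triangles_or_cherries f01 gamma_range bounds anti small).
  rewrite mulr_gt0 ?subr_gt0 ?invf_lt1 ?ltr1n //= -/s.
  by rewrite gtr_pMr // gtrBl invr_gt0.
apply: filterS3 (ae_one_step G_process f01) (ae_foralln H1) (ae_foralln H2).
move=> omega steps up lo; apply/cvgrPdist_le => eps eps0.
have [j1 Hj1] : exists j : nat, j.+1%:R^-1 <= eps / 16.
  exists (Num.truncn (eps / 16)^-1); have e0 : 0 < eps / 16 by rewrite divr_gt0.
  by rewrite -[leRHS]invrK lef_pV2 ?posrE ?invr_gt0 // ltW // truncnS_gt.
have [M1 _ up1] := up j1; have [M2 _ lo2] := lo j1.
rewrite /many /few in up1 lo2.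
set r := s + j1.+1%:R^-1 in up1; set l := s * (1 - j1.+2%:R^-1) in lo2.
have inv0 : 0 < j1.+1%:R^-1 :> R by rewrite invr_gt0.
have inv2 : j1.+2%:R^-1 <= j1.+1%:R^-1 :> R.
  by rewrite lef_pV2 ?posrE ?ltr0n // ler_nat.
have s1 : s <= 1 by rewrite gerBl.
have rs : r <= s + eps / 16 by rewrite lerD2l.
have r0 : 0 < r by rewrite addr_gt0.
have l0 : 0 < l.
  by rewrite mulr_gt0 // subr_gt0 invf_lt1 ?ltr0n // ltr1n.
have ls : s - eps / 16 <= l.
  rewrite /l mulrBr mulr1 lerD2l lerN2 (le_trans _ Hj1) // (le_trans _ inv2) //.
  by rewrite ler_piMl // invr_ge0.
have ls' : l <= s by rewrite /l ler_piMr ?(ltW s0) // gerBl invr_ge0.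
(* Dominates the constant terms of both bounds on the logarithm; for large [n] it is at most
   [eps / 16 * ln n], and the errors in [r] and [l] stay below [eps] in total. *)
pose A : R := ln 3 + (2 * r + 2 * s) * ln 2.
near=> n.
have n2 : (2 ^ maxn M1 M2 <= n)%N by near: n; exact: nbhs_infty_ge.
have n0 : (0 < n)%N by apply: leq_trans n2; rewrite expn_gt0.
have nA : 16 * A / eps <= ln (n%:R : R).
  have : expR (16 * A / eps) <= n%:R by near: n; exact: nbhs_infty_ger.
  by rewrite -[X in _ -> X <= _]expRK ler_ln ?posrE ?expR_gt0 // ltr0n.
have n1 : 1 <= ln (n%:R : R).
  have : expR 1 <= n%:R :> R by near: n; exact: nbhs_infty_ger.
  by rewrite -[X in _ -> X <= _]expRK ler_ln ?posrE ?expR_gt0 // ltr0n.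
have [k kn] := dyadic n0.
have kM : (maxn M1 M2 <= k)%N.
  have /andP[_ nk] := kn; rewrite -ltnS -(ltn_exp2l _ _ (isT : 1 < 2)%N).
  exact: leq_ltn_trans n2 nk.
rewrite geq_max in kM; move/andP: kM => [kM1 kM2].
have := up1 k.+1 (leqW kM1); rewrite /= negb_or -!leNgt => /andP[adjU nvU].
have := lo2 k kM2; rewrite /= negb_or -!leNgt => /andP[triL cheL].
have [] := ln_global_clustering_bounds steps kn l0 r0 adjU nvU triL cheL.
have ln2 : 0 <= ln 2 :> R by rewrite ln_ge0 // ler1n.
have ln3 : 0 <= ln 3 :> R by rewrite ln_ge0 // ler1n.
move: nA n1; set N := ln (n%:R : R) => nA n1.
set L := ln (global_clustering R (G n omega)) => lo1 up2.
have N0 : 0 < N by apply: lt_le_trans n1.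
have AN : A <= eps / 16 * N.
  by move: nA; rewrite ler_pdivrMr // => nA; lra.
have sl : (s - eps / 16) * N <= l * N by rewrite ler_wpM2r // ltW.
have rN : r * N <= (s + eps / 16) * N by rewrite ler_wpM2r // ltW.
have ll2 : l * ln 2 <= s * ln 2 by rewrite ler_wpM2r.
have rl2 : 0 <= r * ln 2 by rewrite mulr_ge0 // ltW.
have sl2 : 0 <= s * ln 2 by rewrite mulr_ge0 // ltW.
rewrite -normrN opprB ler_norml; apply/andP; split.
  rewrite lerBrDr ler_pdivlMr // mulrDl.
  rewrite /A in AN; lra.
rewrite lerBlDr ler_pdivrMr //.
rewrite /A in AN; lra.
Unshelve. all: by end_near. Qed.
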